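(* There is no smooth, transversely orientable foliation of codimension one of the Euclidean sphere $\mathbb{S}^{n+1}$ whose leaves are complete and have constant scalar curvature greater than one.
   Context: $\mathbb{S}^{n+1}$ is the unit sphere with its standard metric of constant sectional curvature $1$. A smooth codimension-one foliation $\mathcal F$ of a Riemannian manifold $\overline M$ is transversely orientable if there is a smooth unit vector field $N$ on $\overline M$ that is normal to the leaves of $\mathcal F$. Leaves carry the induced Riemannian metric. Each leaf $L$ has scalar curvature equal to a constant $R_L>1$, where $R_L$ may depend on the leaf. The scalar curvature $R_L$ of an $n$-dimensional leaf is normalized (the trace of the Ricci tensor divided by $n(n-1)$, with $n\ge2$, so that a unit sphere has scalar curvature $1$); thus, by Gauss' equation, $2S_2=n(n-1)(R_L-1)$, where $S_2$ is the second elementary symmetric function of the principal curvatures of $L$. *)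

(* Defs.v *)
From HB Require Import structures.
From mathcomp Require Import all_boot all_order all_algebra.
From mathcomp Require Import all_classical all_reals all_analysis.

Set Implicit Arguments.
Unset Strict Implicit.
Unset Printing Implicit Defensive.

Import Order.TTheory GRing.Theory Num.Theory.
Import numFieldNormedType.Exports.

Local Open Scope classical_set_scope.
Local Open Scope ring_scope.

Section Smooth.
Variable R : realType.

(* The norm of 'rV[R]_m in the library is the sup norm, hence an explicit
   Euclidean inner product. *)
Definition dotp m (u v : 'rV[R]_m) : R := \sum_(i < m) u 0 i * v 0 i.

(* the d-sphere in R^(d + 1) *)
Definition unit_sphere d : set 'rV[R]_d.+1 := [set x | dotp x x = 1].

Definition pderiv m (V : normedModType R) (i : 'I_m) (f : 'rV[R]_m -> V)
  : 'rV[R]_m -> V := fun x => 'D_(delta_mx 0 i) f x.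

(* C^oo on an open set: all the iterated partial derivatives exist and are
   continuous. *)
Definition smooth_open m (V : normedModType R) (O : set 'rV[R]_m)
    (f : 'rV[R]_m -> V) : Prop :=
  forall (s : seq 'I_m) (x : 'rV[R]_m), O x ->
    {for x, continuous (foldr (@pderiv m V) f s)} /\
    forall i : 'I_m, derivable (foldr (@pderiv m V) f s) x (delta_mx 0 i).

(* Smoothness on an arbitrary subset A of R^m: locally, f is the restriction to
   A of a C^oo map defined on an open set of R^m.  Values of f off A are
   irrelevant. *)
Definition smooth_on m (V : normedModType R) (A : set 'rV[R]_m)
    (f : 'rV[R]_m -> V) : Prop :=
  forall x, A x -> exists (O : set 'rV[R]_m) (F : 'rV[R]_m -> V),
    [/\ open O, O x, smooth_open O F & forall y, A y -> O y -> F y = f y].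

End Smooth.
Arguments unit_sphere R d : clear implicits.

(* Riemannian geometry in one coordinate patch; g x is the Gram matrix
   (g_ij(x)) of the metric in the coordinates x. *)
Section LocalRiemann.
Variables (R : realType) (n : nat) (g : 'rV[R]_n -> 'M[R]_n).

(* Gamma^k_ij of the Levi-Civita connection *)
Definition christoffel (k i j : 'I_n) (x : 'rV[R]_n) : R :=
  2^-1 * \sum_(l < n) invmx (g x) k l *
    (pderiv i (fun y => g y j l) x + pderiv j (fun y => g y i l) x
     - pderiv l (fun y => g y i j) x).

(* R(d_i, d_j) d_k = \sum_l (riemann l k i j) d_l, with the convention
   R(X, Y) Z = D_X D_Y Z - D_Y D_X Z - D_[X, Y] Z. *)
Definition riemann (l k i j : 'I_n) (x : 'rV[R]_n) : R :=
  pderiv i (christoffel l j k) x - pderiv j (christoffel l i k) x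
  + \sum_(p < n) (christoffel l i p x * christoffel p j k x
                  - christoffel l j p x * christoffel p i k x).

(* Ric(Y, Z) = tr (X |-> R(X, Y) Z), which is positive on round spheres *)
Definition ricci (j k : 'I_n) (x : 'rV[R]_n) : R :=
  \sum_(i < n) riemann i k i j x.

(* normalized: equal to 1 on the unit n-sphere *)
Definition scalar_curvature (x : 'rV[R]_n) : R :=
  (\sum_(j < n) \sum_(k < n) invmx (g x) j k * ricci j k x)
  / (n%:R * (n%:R - 1)).

Definition geodesic_eq_at (x : R -> 'rV[R]_n) (t : R) : Prop :=
  forall k : 'I_n,
    let c (i : 'I_n) : R -> R := fun s => x s 0 i in
    [/\ derivable (c k) t 1, derivable (derive1 (c k)) t 1
      & derive1 (derive1 (c k)) t
        + \sum_(i < n) \sum_(j < n)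
            christoffel k i j (x t) * derive1 (c i) t * derive1 (c j) t = 0].

End LocalRiemann.

(* Codimension-one foliations of a submanifold M of R^m, dim M = n + 1.
   Coordinates in R^(n + 1) are z = row_mx x y, x in R^n along the leaves, and
   y in R^1 transverse to them. *)
Section Foliation.
Variables (R : realType) (n m : nat).

Definition cube : set 'rV[R]_(n + 1) := [set z | forall j, `|z 0 j| < 1].

(* A chart is given by coord : U -> cube together with its inverse
   param : cube -> U; values of coord off U, and of param off the cube, are
   irrelevant. *)
Record chart := Chart {
  coord : 'rV[R]_m -> 'rV[R]_(n + 1) ;
  param : 'rV[R]_(n + 1) -> 'rV[R]_m }.

Definition chart_dom (c : chart) : set 'rV[R]_m := param c @` cube.

(* coord is a diffeomorphism of a relatively open subset of M onto the cube *)
Definition smooth_chart (M : set 'rV[R]_m) (c : chart) : Prop :=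
  [/\ exists2 O : set 'rV[R]_m, open O & chart_dom c = M `&` O,
      forall z, cube z -> coord c (param c z) = z,
      smooth_on cube (param c)
    & smooth_on (chart_dom c) (coord c)].

(* The change of coordinates has, locally, the form
   (x, y) |-> (h1 (x, y), h2 y). *)
Definition foliated_transition (c c' : chart) : Prop :=
  forall z, cube z -> chart_dom c' (param c z) ->
    exists h2 : 'rV[R]_1 -> 'rV[R]_1,
      \forall w \near z, cube w -> chart_dom c' (param c w) ->
        rsubmx (coord c' (param c w)) = h2 (rsubmx w).

Definition foliation (M : set 'rV[R]_m) (A : set chart) : Prop :=
  [/\ forall c, A c -> smooth_chart M c,
      forall p, M p -> exists2 c, A c & chart_dom c p
    & forall c c', A c -> A c' -> foliated_transition c c'].

Definition plaque_map (c : chart) (y : 'rV[R]_1) (x : 'rV[R]_n) : 'rV[R]_m :=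
  param c (row_mx x y).

Definition same_plaque (A : set chart) (p q : 'rV[R]_m) : Prop :=
  exists (c : chart) (x x' : 'rV[R]_n) (y : 'rV[R]_1),
    [/\ A c, cube (row_mx x y), cube (row_mx x' y),
        p = plaque_map c y x & q = plaque_map c y x'].

(* p and q are joined by a finite chain of plaques *)
Inductive same_leaf (A : set chart) (p : 'rV[R]_m) : 'rV[R]_m -> Prop :=
| same_leaf_plaque q : same_plaque A p q -> same_leaf A p q
| same_leaf_chain q r : same_leaf A p q -> same_plaque A q r -> same_leaf A p r.

Definition is_leaf (M : set 'rV[R]_m) (A : set chart) (L : set 'rV[R]_m) :=
  exists2 p, M p & L = [set q | same_leaf A p q].

(* There is a smooth unit vector field on M which is tangent to M and normal
   to the leaves. *)
Definition transversely_orientable (M : set 'rV[R]_m) (A : set chart) : Prop :=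
  exists N : 'rV[R]_m -> 'rV[R]_m,
    [/\ smooth_on M N,
        forall p, M p -> dotp (N p) (N p) = 1,
        forall c z, A c -> cube z ->
          exists v, N (param c z) = 'D_v (param c) z
      & forall c x y, A c -> cube (row_mx x y) -> forall i : 'I_n,
          dotp (N (plaque_map c y x)) (pderiv i (plaque_map c y) x) = 0].

(* The metric induced by the Euclidean metric on a plaque, in the coordinates x.
   As dotp is the metric that M itself inherits from R^m, this is also the metric
   induced by that of M. *)
Definition plaque_metric (c : chart) (y : 'rV[R]_1) (x : 'rV[R]_n) : 'M[R]_n :=
  \matrix_(i, j) dotp (pderiv i (plaque_map c y) x)
                      (pderiv j (plaque_map c y) x).

Definition leaf_scalar_curvature (A : set chart) (L : set 'rV[R]_m) (r : R) :=
  forall c x y, A c -> cube (row_mx x y) -> L (plaque_map c y x) ->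
    scalar_curvature (plaque_metric c y) x = r.

(* gamma restricted to the open set I is a geodesic of the leaf L: near each time
   it runs in one plaque, where its coordinates solve the geodesic equation. *)
Definition leaf_geodesic (A : set chart) (L : set 'rV[R]_m) (I : set R)
    (gamma : R -> 'rV[R]_m) : Prop :=
  forall t, I t -> L (gamma t) /\
    exists (c : chart) (y : 'rV[R]_1) (x : R -> 'rV[R]_n), A c /\
      \forall s \near t,
        [/\ cube (row_mx (x s) y), gamma s = plaque_map c y (x s)
          & geodesic_eq_at (plaque_metric c y) x s].

(* every geodesic of L extends to a geodesic defined for all times *)
Definition complete_leaf (A : set chart) (L : set 'rV[R]_m) : Prop :=
  forall (a b : R) (gamma : R -> 'rV[R]_m), a < b ->
    leaf_geodesic A L `]a, b[ gamma ->
    exists2 gamma', leaf_geodesic A L setT gamma'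
      & forall t, a < t < b -> gamma' t = gamma t.

End Foliation.

(* Main.v *)
Require Import Defs.
From HB Require Import structures.
From mathcomp Require Import all_boot all_order all_algebra.
From mathcomp Require Import all_classical all_reals all_analysis.
From mathcomp Require Import ring lra.
Import Order.TTheory GRing.Theory Num.Theory.
Import numFieldNormedType.Exports.
Local Open Scope classical_set_scope.
Local Open Scope ring_scope.

(** Extend the unit normal N of the foliation from the unit sphere of R^m, m = n + 2, to R^m minus the
    origin as a function that is homogeneous of degree 0.  The extrinsic geometry of the leaves is
    then contained in the Jacobian D of N: on the tangent space of the leaf through x / |x| it is
    - A / |x|, where A is the shape operator, and the remaining part of D is strictly triangular for
    the splitting into N, that tangent space and x, so that tr D^k = tr (- A)^k / |x|^k
    ([homogeneous_traces]).  Write S_1, S_2 for the first two elementary symmetric functions of A.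
    Then S_1 = - |x| div N, and S_2 = |x|^2 sigma_2(D) is the function [nsigma2].

    The Gauss equation ([gauss_equation], [plaque_scalar_curvature]) says 2 S_2 = n (n - 1) (R_L - 1).
    So S_2 is positive, and it is constant on the leaves: its gradient is a multiple of N
    ([leaf_frame], [grad_nsigma2_normal]).

    Let Y ([newtonN]) be the field which on the sphere is T_1 (D_N N), where T_1 = S_1 - A is the
    first Newton transformation.  It is tangent to the leaves, and a computation in flat R^m gives
    ([div_newtonN])
      div Y = tr D^3 - (tr D) (tr D^2) - N (sigma_2) - (n - 1) (tr D) / |x|^2.
    Only the derivative of sigma_2 along N has no sign.  A weight that is a function of S_2 has no
    derivative in the direction of Y, and with the field Z = exp (2 S_2) (2 Y + N / |x|^2) ([wfield])
    the derivative of the weight along N cancels that term ([div_wfield]):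
      div Z = exp (2 S_2) (2 tr D^3 - 2 (tr D) (tr D^2) - (2 n - 3) (tr D) / |x|^2).
    As S_2 > 0, we have tr D^2 < (tr D)^2, while |tr D^3| <= (tr D^2)^(3/2) because A is symmetric.
    Hence tr D never vanishes and the bracket has the sign of - tr D ([divergence_sign]), which is
    locally constant.  Multiplying Z by this sign and by a cutoff function of |x|, to whose gradient
    Z is orthogonal, gives a C^1 field with compact support in R^m whose divergence is nonnegative
    and somewhere positive.  The divergence theorem forbids that.  It is proved here in the form that
    is needed, with sums over fine grids in the place of integrals ([compact_support_divergence]). *)

Set Implicit Arguments.
Unset Strict Implicit.
Unset Printing Implicit Defensive.

(** * Mean value theorem and differentiability of C^1 functions *)

Section LineMVT.
Context {R : realType} {V : normedModType R}.
Implicit Types (f : V -> R) (x v : V).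

Lemma is_derive_line f x v (s : R) :
  derivable f (x + s *: v) v ->
  is_derive s 1 (fun t : R => f (x + t *: v)) ('D_v f (x + s *: v)).
Proof.
have E : (fun h : R => h^-1 *: (((fun t : R => f (x + t *: v)) \o shift s) (h *: (1:R)) -
    f (x + s *: v))) = (fun h : R => h^-1 *: ((f \o shift (x + s *: v)) (h *: v) - f (x + s *: v))).
  apply/funext => h /=; congr (_ *: (f _ - _)).
  by rewrite [h *: (1:R)]mulr1 scalerDl addrCA.
move=> df; split; rewrite /derivable /derive E //.
Qed.

Lemma MVT_line f x v (t : R) : 0 <= t ->
  (forall s, 0 <= s <= t -> derivable f (x + s *: v) v) ->
  exists2 s, 0 <= s <= t & f (x + t *: v) - f x = t * 'D_v f (x + s *: v).
Proof.
move=> t0 df.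
have dg s : s \in `]0, t[%R -> is_derive s 1 (fun s => f (x + s *: v)) ('D_v f (x + s *: v)).
  rewrite in_itv/= => /andP[s0 st]; apply: is_derive_line; apply: df.
  by rewrite !ltW.
have cg : {within `[0, t], continuous (fun s => f (x + s *: v))}.
  apply: derivable_within_continuous => s; rewrite in_itv/= => st.
  by have [] := is_derive_line (df s st).
have [s] := MVT_segment t0 dg cg.
rewrite in_itv/= => st; rewrite scale0r addr0 subr0 mulrC => ->.
by exists s.
Qed.

Lemma MVT_line_signed f x v (t : R) :
  (forall s, `|s| <= `|t| -> derivable f (x + s *: v) v) ->
  exists2 s, `|s| <= `|t| & f (x + t *: v) - f x = t * 'D_v f (x + s *: v).
Proof.
move=> df; have [t0|t0] := leP 0 t.
  have [s /andP[s0 st] E] : exists2 s, 0 <= s <= t & f (x + t *: v) - f x = t * 'D_v f (x + s *: v).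
    by apply: MVT_line => // s /andP[s0 st]; apply: df; rewrite !ger0_norm.
  by exists s => //; rewrite !ger0_norm.
have nt : 0 <= - t by rewrite oppr_ge0 ltW.
have [s /andP[s0 st] E] : exists2 s, 0 <= s <= - t &
    f ((x + t *: v) + (- t) *: v) - f (x + t *: v) = - t * 'D_v f ((x + t *: v) + s *: v).
  apply: MVT_line => // s /andP[s0 st]; rewrite -addrA -scalerDl; apply: df.
  by rewrite !ler0_norm ?(ltW t0)//; lra.
exists (t + s); first by rewrite !ler0_norm ?(ltW t0)//; lra.
move: E; rewrite -!addrA -!scalerDl subrr scale0r addr0 => E.
by rewrite -opprB E; ring.
Qed.

End LineMVT.

Section C1.
Context {R : realType} {m : nat}.
Implicit Types (f : 'rV[R]_m -> R) (x v : 'rV[R]_m).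

Lemma ball_rV_coord (x y : 'rV[R]_m) (e : R) : 0 < e ->
  (forall j, `|y 0 j - x 0 j| < e) -> ball x e y.
Proof.
move=> e0 H; rewrite -ball_normE /ball_/=.
rewrite [ltLHS]/Num.Def.normr/= mx_normrE; apply: bigmax_lt => //= -[i j] _.
by rewrite !mxE/= ord1 distrC; exact: H.
Qed.

Lemma ler_coord_norm (v : 'rV[R]_m) j : `|v 0 j| <= `|v|.
Proof.
by rewrite [leRHS]/Num.Def.normr/= mx_normrE; exact: (le_bigmax _ (fun ij => `|v ij.1 ij.2|) (0,j)).
Qed.

Definition coord_prefix (k : nat) v : 'rV[R]_m := \row_j (if (j < k)%N then v 0 j else 0).

Lemma coord_prefixS v (i : 'I_m) : coord_prefix i.+1 v = coord_prefix i v + v 0 i *: delta_mx 0 i.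
Proof.
apply/rowP => j; rewrite !mxE eqxx /= ltnS leq_eqVlt.
have [->|ne] := eqVneq j i; first by rewrite eqxx ltnn /= mulr1 add0r.
have /negPf -> : (nat_of_ord j != nat_of_ord i)%N := ne.
by rewrite /= mulr0 addr0.
Qed.

(** Going from x to x + v one coordinate at a time, each step is governed by the mean value
    theorem, and the partial derivatives met on the way are close to those at x. *)
Lemma C1_increment f x :
  (forall i, \forall y \near x, derivable f y (delta_mx 0 i)) ->
  (forall i, {for x, continuous (pderiv i f)}) ->
  forall e, 0 < e -> \forall v \near (0 : 'rV[R]_m),
    `|f (x + v) - f x - \sum_i v 0 i * pderiv i f x| <= e * `|v|.
Proof.
move=> df cf e e0.
pose e1 := e / (m%:R + 1).
have e10 : 0 < e1 by rewrite divr_gt0// ltr_wpDl.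
have near_i i : \forall y \near x, derivable f y (delta_mx 0 i) /\ `|pderiv i f x - pderiv i f y| < e1.
  have ci : \forall y \near x, `|pderiv i f x - pderiv i f y| < e1.
    by have /cvgrPdist_lt := cf i; apply.
  by apply: filterS2 (df i) ci; split.
have : \forall y \near x, forall i, derivable f y (delta_mx 0 i) /\ `|pderiv i f x - pderiv i f y| < e1.
  exact: filter_forall near_i.
move=> /nbhs_ballP[d /= d0 Hd].
near=> v.
have vd : `|v| < d.
  by near: v; exact: (@nbhs0_lt _ ('rV[R]_m : normedModType R) d d0).
have cutm : coord_prefix m v = v by apply/rowP => j; rewrite mxE ltn_ord.
have cut0 : coord_prefix 0 v = 0 by apply/rowP => j; rewrite !mxE.
have tel : f (x + v) - f x = \sum_(i < m) (f (x + coord_prefix i.+1 v) - f (x + coord_prefix i v)).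
  rewrite -(big_mkord xpredT (fun i => f (x + coord_prefix i.+1 v) - f (x + coord_prefix i v))).
  by rewrite (telescope_sumr (fun i => f (x + coord_prefix i v)) (leq0n m)) cutm cut0 addr0.
have near_cut (i : 'I_m) (s : R) : `|s| <= `|v 0 i| ->
    ball x d (x + coord_prefix i v + s *: delta_mx 0 i).
  move=> sv; apply: ball_rV_coord => // j; rewrite !mxE eqxx /= -addrA addrAC subrr add0r.
  apply: le_lt_trans vd; have [->|ji] := eqVneq j i.
    by rewrite ltnn add0r mulr1 (le_trans sv)// ler_coord_norm.
  by rewrite mulr0 addr0; case: ifP => _; rewrite ?normr0// ler_coord_norm.
rewrite tel -sumrB.
apply: (@le_trans _ _ (\sum_(i < m) e1 * `|v|)); last first.
  rewrite sumr_const card_ord -[leLHS]mulr_natr mulrAC ler_wpM2r//.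
  by rewrite /e1 mulrAC ler_pdivrMr ?ler_wpM2l ?(ltW e0)// ?ltr_wpDl// lerDl.
apply: (le_trans (ler_norm_sum _ _ _)); apply: ler_sum => i _.
have [s sv ->] : exists2 s, `|s| <= `|v 0 i| & f (x + coord_prefix i.+1 v) - f (x + coord_prefix i v) =
    v 0 i * pderiv i f (x + coord_prefix i v + s *: delta_mx 0 i).
  rewrite coord_prefixS addrA; apply: MVT_line_signed => s sv.
  by have [] := Hd _ (near_cut _ _ sv) i.
rewrite -mulrBr normrM mulrC ler_pM ?ler_coord_norm//.
by have [_ /ltW] := Hd _ (near_cut _ _ sv) i; rewrite distrC.
Unshelve. all: by end_near. Qed.

Lemma linear_coord_sum (c : 'I_m -> R) :
  linear (fun v : 'rV[R]_m => \sum_i v 0 i * c i : R).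
Proof.
move=> k u v /=; rewrite scaler_sumr -big_split /=; apply: eq_bigr => i _.
by rewrite !mxE mulrDl -mulrA.
Qed.

Lemma C1_differentiable f x :
  (forall i, \forall y \near x, derivable f y (delta_mx 0 i)) ->
  (forall i, {for x, continuous (pderiv i f)}) -> differentiable f x.
Proof.
move=> df cf.
pose dfM := GRing.isLinear.Build _ _ _ _ _ (linear_coord_sum (fun i => pderiv i f x)).
pose dfL : {linear 'rV[R]_m -> R} := HB.pack (fun v : 'rV[R]_m => \sum_i v 0 i * pderiv i f x : R) dfM.
have dfE v : dfL v = \sum_i v 0 i * pderiv i f x by [].
have dfc : continuous dfL.
  apply: (@continuous_big _ _ +%R) => [|i _ v]; first exact: add_continuous.
  have cc : {for v, continuous (fun v : 'rV[R]_m => v 0 i : R)} by exact: coord_continuous.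
  have ck : {for v, continuous (fun _ : 'rV[R]_m => pderiv i f x)} by exact: cst_continuous.
  exact: continuousM cc ck.
have dfo : f \o shift x = cst (f x) + dfL +o_ (0 : 'rV[R]_m) id.
  apply/eqaddoP => e e0.
  have := C1_increment df cf e0; apply: filterS => v.
  by rewrite -![(_ + _ : _ -> _) _]/(_ + _) -![(- _ : _ -> _) _]/(- _) /= opprD addrA (addrC v).
apply/diff_locallyP; rewrite (diff_unique dfc dfo); split => //.
Qed.

End C1.

(** * Functions of class C^k *)

Section Ck.
Context {R : realType} {m : nat}.
Implicit Types (f g : 'rV[R]_m -> R) (x v : 'rV[R]_m) (O : set 'rV[R]_m).

(** The recursion on partial derivatives turns each closure property below into an induction on k. *)
Fixpoint Ck (k : nat) O f : Prop :=
  (forall x, O x -> {for x, continuous f}) /\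
  if k is k'.+1 then
    (forall x, O x -> forall i, derivable f x (delta_mx 0 i)) /\
    (forall i, Ck k' O (pderiv i f))
  else True.

Lemma Ck_continuous k O f x : Ck k O f -> O x -> {for x, continuous f}.
Proof. by case: k => [|k] [cf _]; exact: cf. Qed.

Lemma Ck_derivable k O f x i : Ck k.+1 O f -> O x -> derivable f x (delta_mx 0 i).
Proof. by move=> [_ [df _]] Ox; exact: df. Qed.

Lemma Ck_pderiv k O f i : Ck k.+1 O f -> Ck k O (pderiv i f).
Proof. by move=> [_ [_ pf]]; exact: pf. Qed.

Lemma Ck_pred k O f : Ck k.+1 O f -> Ck k O f.
Proof.
elim: k f => [|k IH] f; first by move=> [].
by move=> [cf [df pf]]; split=> //; split => // i; apply: IH; exact: pf.
Qed.

Lemma Ck_le k l O f : (k <= l)%N -> Ck l O f -> Ck k O f.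
Proof.
move=> /subnK <-; elim: (l - k)%N => // j IH; rewrite addSn => /Ck_pred; exact: IH.
Qed.

Lemma Ck_sub k O O' f : O' `<=` O -> Ck k O f -> Ck k O' f.
Proof.
move=> s; elim: k f => [|k IH] f [cf H].
  by split=> // x /s Ox; exact: (cf x Ox).
split; first by move=> x /s Ox; exact: (cf x Ox).
by case: H => df pf; split=> [x /s Ox i|i]; [exact: (df x Ox)|apply: IH; exact: pf].
Qed.

(** Smoothness on a subset is defined through local extensions; this glues them on an open set. *)
Lemma Ck_local k O f :
  (forall x, O x -> exists2 O', O' x & Ck k O' f) -> Ck k O f.
Proof.
elim: k f => [|k IH] f H.
  by split=> // x /H[U Ux /Ck_continuous cf]; exact: cf.
split=> [x /H[U Ux /Ck_continuous cf]|]; first exact: cf.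
split=> [x /H[U Ux /Ck_derivable H'] i|i]; first exact: H'.
by apply: IH => x /H[U Ux /Ck_pderiv H']; exists U.
Qed.

Lemma near_open O x : open O -> O x -> \forall y \near x, O y.
Proof. by move=> oO Ox; exact: open_nbhs_nbhs. Qed.

Lemma eq_pderiv O f g x i : open O -> O x -> (forall y, O y -> f y = g y) ->
  pderiv i f x = pderiv i g x.
Proof.
move=> oO Ox fg; apply: near_eq_derive.
by apply: filterS (near_open oO Ox).
Qed.

Lemma eq_continuous O f g x : open O -> O x -> (forall y, O y -> f y = g y) ->
  {for x, continuous f} -> {for x, continuous g}.
Proof.
move=> oO Ox fg cf.
have nfg : \forall y \near x, f y = g y by apply: filterS fg _; exact: near_open.
suff : g y @[y --> x] --> g x by [].
by rewrite -fg//; exact: cvg_trans (near_eq_cvg nfg) cf.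
Qed.

Lemma Ck_ext k O f g : open O -> (forall x, O x -> f x = g x) -> Ck k O f -> Ck k O g.
Proof.
move=> oO; elim: k f g => [|k IH] f g fg [cf H].
  by split=> // x Ox; exact: (eq_continuous oO Ox fg (cf x Ox)).
split; first by move=> x Ox; exact: (eq_continuous oO Ox fg (cf x Ox)).
case: H => df pf; split=> [x Ox i|i].
  apply: near_eq_derivable (df x Ox i).
  by apply: filterS (near_open oO Ox) => y /fg.
by apply: IH (pf i) => x Ox; exact: (eq_pderiv i oO Ox fg).
Qed.

Lemma Ck_differentiable k O f x : open O -> Ck k.+1 O f -> O x -> differentiable f x.
Proof.
move=> oO Cf Ox; apply: C1_differentiable => i.
  by apply: filterS (near_open oO Ox) => y Oy; exact: Ck_derivable Cf Oy.
exact: Ck_continuous (Ck_pderiv i Cf) Ox.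
Qed.

Lemma Ck_cst k O (c : R) : Ck k O (fun=> c).
Proof.
have C0 l (c' : R) : Ck l O (fun=> c').
  elim: l c' => [|l IH] c'; (split; first by move=> x _; exact: cst_continuous) => //.
  split=> [x _ i|i]; first exact: derivable_cst.
  rewrite [pderiv i _](_ : _ = fun=> 0)//; apply/funext => x; exact: derive_cst.
exact: C0.
Qed.

Lemma pderiv_cst i (c : R) x : pderiv i (fun=> c) x = 0.
Proof. exact: derive_cst. Qed.

Lemma is_derive_coord (j : 'I_m) x v :
  is_derive x v (fun y : 'rV[R]_m => y 0 j : R) (v 0 j).
Proof.
have [dx dE] := is_derive_id x v.
split; first by move/derivable_mxP : dx => /(_ 0 j).
by move: dE; rewrite derive_mx// => /rowP/(_ j); rewrite mxE.
Qed.

Lemma pderiv_coord i (j : 'I_m) x :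
  pderiv i (fun y : 'rV[R]_m => y 0 j : R) x = (j == i)%:R.
Proof. by have [_] := is_derive_coord j x (delta_mx 0 i); rewrite /pderiv => ->; rewrite mxE eqxx. Qed.

Lemma Ck_coord k O (j : 'I_m) : Ck k O (fun x => x 0 j).
Proof.
have C0 x : {for x, continuous (fun y : 'rV[R]_m => y 0 j : R)} by exact: coord_continuous.
case: k => [|k]; split=> //; split=> [x _ i|i].
  by have [] := is_derive_coord j x (delta_mx 0 i).
rewrite [pderiv i _](_ : _ = fun=> (j == i)%:R); first exact: Ck_cst.
by apply/funext => x; exact: pderiv_coord.
Qed.

Section Ops.
Variables (O : set 'rV[R]_m) (oO : open O).

Lemma pderivD i f g x : derivable f x (delta_mx 0 i) -> derivable g x (delta_mx 0 i) ->
  pderiv i (fun y => f y + g y) x = pderiv i f x + pderiv i g x.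
Proof. exact: deriveD. Qed.

Lemma pderivM i f g x : derivable f x (delta_mx 0 i) -> derivable g x (delta_mx 0 i) ->
  pderiv i (fun y => f y * g y) x = pderiv i f x * g x + f x * pderiv i g x.
Proof. by move=> df dg; rewrite /pderiv (deriveM df dg) addrC /= mulrC. Qed.

Lemma pderivV i f x : f x != 0 -> derivable f x (delta_mx 0 i) ->
  pderiv i (fun y => (f y)^-1) x = - (f x)^-1 * (f x)^-1 * pderiv i f x.
Proof. by move=> f0 df; rewrite /pderiv deriveV// expr2 invfM -mulNr. Qed.

Lemma CkD k f g : Ck k O f -> Ck k O g -> Ck k O (fun x => f x + g x).
Proof.
elim: k f g => [|k IH] f g Cf Cg.
  by split=> // x Ox; apply: continuousD; [exact: Ck_continuous Cf Ox|exact: Ck_continuous Cg Ox].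
split; first by move=> x Ox; apply: continuousD; [exact: Ck_continuous Cf Ox|exact: Ck_continuous Cg Ox].
split=> [x Ox i|i]; first by apply: derivableD; [exact: Ck_derivable Cf Ox|exact: Ck_derivable Cg Ox].
apply: Ck_ext (IH _ _ (Ck_pderiv i Cf) (Ck_pderiv i Cg)) => // x Ox.
by rewrite pderivD//; [exact: Ck_derivable Cf Ox|exact: Ck_derivable Cg Ox].
Qed.

Lemma CkM k f g : Ck k O f -> Ck k O g -> Ck k O (fun x => f x * g x).
Proof.
elim: k f g => [|k IH] f g Cf Cg.
  by split=> // x Ox; apply: continuousM; [exact: Ck_continuous Cf Ox|exact: Ck_continuous Cg Ox].
split; first by move=> x Ox; apply: continuousM; [exact: Ck_continuous Cf Ox|exact: Ck_continuous Cg Ox].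
split=> [x Ox i|i]; first by apply: derivableM; [exact: Ck_derivable Cf Ox|exact: Ck_derivable Cg Ox].
apply: Ck_ext (CkD (IH _ _ (Ck_pderiv i Cf) (Ck_pred Cg)) (IH _ _ (Ck_pred Cf) (Ck_pderiv i Cg))) => // x Ox.
by rewrite pderivM//; [exact: Ck_derivable Cf Ox|exact: Ck_derivable Cg Ox].
Qed.

Lemma CkV k f : (forall x, O x -> f x != 0) -> Ck k O f -> Ck k O (fun x => (f x)^-1).
Proof.
move=> f0; elim: k => [|k IH] Cf.
  by split=> // x Ox; apply: continuousV; [exact: f0|exact: Ck_continuous Cf Ox].
split; first by move=> x Ox; apply: continuousV; [exact: f0|exact: Ck_continuous Cf Ox].
split=> [x Ox i|i]; first by apply: derivableV; [exact: f0|exact: Ck_derivable Cf Ox].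
have CV := IH (Ck_pred Cf).
apply: Ck_ext (CkM (CkM (CkM (Ck_cst k O (-1)) CV) CV) (Ck_pderiv i Cf)) => // x Ox.
by rewrite pderivV ?mulN1r//; [exact: f0|exact: Ck_derivable Cf Ox].
Qed.

Lemma CkN k f : Ck k O f -> Ck k O (fun x => - f x).
Proof.
move=> Cf; apply: Ck_ext (CkM (Ck_cst k O (-1)) Cf) => // x Ox.
by rewrite mulN1r.
Qed.

Lemma CkB k f g : Ck k O f -> Ck k O g -> Ck k O (fun x => f x - g x).
Proof. by move=> Cf Cg; exact: CkD Cf (CkN Cg). Qed.

Lemma Ck_sum k (I : Type) (r : seq I) (P : pred I) (F : I -> 'rV[R]_m -> R) :
  (forall i, P i -> Ck k O (F i)) -> Ck k O (fun x => \sum_(i <- r | P i) F i x).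
Proof.
move=> CF; elim: r => [|a r IH].
  by apply: Ck_ext (Ck_cst k O 0) => // x _; rewrite big_nil.
have [Pa|Pa] := boolP (P a).
  by apply: Ck_ext (CkD (CF _ Pa) IH) => // x _; rewrite big_cons Pa.
by apply: Ck_ext IH => // x _; rewrite big_cons (negPf Pa).
Qed.

Lemma Ck_prod k (I : Type) (r : seq I) (P : pred I) (F : I -> 'rV[R]_m -> R) :
  (forall i, P i -> Ck k O (F i)) -> Ck k O (fun x => \prod_(i <- r | P i) F i x).
Proof.
move=> CF; elim: r => [|a r IH].
  by apply: Ck_ext (Ck_cst k O 1) => // x _; rewrite big_nil.
have [Pa|Pa] := boolP (P a).
  by apply: Ck_ext (CkM (CF _ Pa) IH) => // x _; rewrite big_cons Pa.
by apply: Ck_ext IH => // x _; rewrite big_cons (negPf Pa).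
Qed.

Lemma chain_rule_scalar (phi : R -> R) (d : R) f x i : Ck 1 O f -> O x ->
  is_derive (f x) 1 phi d ->
  is_derive x (delta_mx 0 i) (fun y => phi (f y)) (d * pderiv i f x).
Proof.
move=> Cf Ox [dphi phiE]; have df := Ck_differentiable oO Cf Ox.
have de : differentiable phi (f x) by apply/derivable1_diffP.
have dc := differentiable_comp df de.
split; first exact: diff_derivable.
have L (r : R) : 'd phi (f x) r = r * d by rewrite diff1E// derive1E phiE.
by rewrite deriveE// diff_comp//= L /pderiv -deriveE// mulrC.
Qed.

Lemma C1_comp_scalar (phi dphi : R -> R) f :
  (forall t : R, is_derive t 1 phi (dphi t)) -> continuous dphi ->
  Ck 1 O f -> Ck 1 O (fun x => phi (f x)).
Proof.
move=> dP cP Cf.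
have cphi : continuous phi.
  move=> t; apply: differentiable_continuous; apply/derivable1_diffP.
  by have [] := dP t.
have cc (g : R -> R) x : continuous g -> O x -> {for x, continuous (fun x => g (f x))}.
  by move=> cg Ox; apply: continuous_comp (Ck_continuous Cf Ox) _; exact: cg.
split; first by move=> x; exact: cc.
split=> [x Ox i|i]; first by have [] := chain_rule_scalar i Cf Ox (dP (f x)).
have C0 : Ck 0 O (fun x => dphi (f x)) by split=> // x; exact: cc.
apply: Ck_ext (CkM C0 (Ck_pderiv i Cf)) => // x Ox.
by have [_] := chain_rule_scalar i Cf Ox (dP (f x)).
Qed.

End Ops.
End Ck.

(** * Chain rule and symmetry of second derivatives *)

Lemma continuous_normP (R : realType) (T : topologicalType) (V : normedModType R) (f : T -> V) x :
  {for x, continuous f} <-> forall e, 0 < e -> \forall y \near x, `|f x - f y| < e.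
Proof. exact: cvgrPdist_lt. Qed.

Lemma derive_sum_pderiv (R : realType) p (f : 'rV[R]_p -> R) x v : differentiable f x ->
  'D_v f x = \sum_i v 0 i * pderiv i f x.
Proof.
move=> df; rewrite deriveE// {1}(row_sum_delta v) linear_sum /=; apply: eq_bigr => i _.
by rewrite linearZ /= /pderiv deriveE.
Qed.

Section Chain.
Context {R : realType} {p m : nat}.
Implicit Types (U : set 'rV[R]_p) (O : set 'rV[R]_m).

Lemma differentiable_rV (rho : 'rV[R]_p -> 'rV[R]_m) x :
  (forall j, differentiable (fun y => rho y 0 j : R) x) -> differentiable rho x.
Proof.
move=> H.
have -> : rho = \sum_(j < m) (fun y => rho y 0 j *: (delta_mx 0 j : 'rV[R]_m)).
  by apply/funext => y; rewrite fct_sumE [LHS]row_sum_delta.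
by apply: differentiable_sum => j; exact: differentiableZl.
Qed.

Lemma chain_rule (rho : 'rV[R]_p -> 'rV[R]_m) (h : 'rV[R]_m -> R) U O x i :
  open U -> open O -> U x -> O (rho x) ->
  (forall j, Ck 1 U (fun y => rho y 0 j)) -> Ck 1 O h ->
  derivable (fun y => h (rho y)) x (delta_mx 0 i) /\
  pderiv i (fun y => h (rho y)) x =
    \sum_j pderiv j h (rho x) * pderiv i (fun y => rho y 0 j) x.
Proof.
move=> oU oO Ux Ox Cr Ch.
have dr : differentiable rho x.
  by apply: differentiable_rV => j; exact: Ck_differentiable (Cr j) Ux.
have dh : differentiable h (rho x) by exact: Ck_differentiable Ch Ox.
have dc := differentiable_comp dr dh.
split; first exact: diff_derivable.
rewrite /pderiv deriveE// diff_comp//= -(deriveE _ dr) -(deriveE _ dh) (derive_sum_pderiv _ dh).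
apply: eq_bigr => j _; rewrite mulrC derive_mx ?mxE//; exact: diff_derivable.
Qed.

Lemma pderiv_component (rho : 'rV[R]_p -> 'rV[R]_m) x i a : derivable rho x (delta_mx 0 i) ->
  derivable (fun y => rho y 0 a : R) x (delta_mx 0 i) /\
  pderiv i (fun y => rho y 0 a : R) x = pderiv i rho x 0 a.
Proof.
move=> dr; split; first by move/derivable_mxP : dr => /(_ 0 a).
by rewrite /pderiv derive_mx// mxE.
Qed.

Lemma continuous_component (rho : 'rV[R]_p -> 'rV[R]_m) x a :
  {for x, continuous rho} -> {for x, continuous (fun y => rho y 0 a : R)}.
Proof.
move=> cr; have cc : {for rho x, continuous (fun v : 'rV[R]_m => v 0 a : R)} by exact: coord_continuous.
exact: continuous_comp cr cc.
Qed.

Lemma continuous_rV (rho : 'rV[R]_p -> 'rV[R]_m) x :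
  (forall a, {for x, continuous (fun y => rho y 0 a : R)}) -> {for x, continuous rho}.
Proof.
move=> H; apply/continuous_normP => e e0.
have near_a a : \forall y \near x, `|rho x 0 a - rho y 0 a| < e.
  by have /continuous_normP := H a; apply.
have : \forall y \near x, forall a, `|rho x 0 a - rho y 0 a| < e.
  exact: filter_forall near_a.
apply: filterS => y Hy.
have : ball (rho x) e (rho y) by apply: ball_rV_coord => // j; rewrite distrC.
by rewrite -ball_normE.
Qed.

Lemma Ck_comp k (rho : 'rV[R]_p -> 'rV[R]_m) (h : 'rV[R]_m -> R) U O :
  open U -> open O -> (forall x, U x -> O (rho x)) ->
  (forall j, Ck k U (fun y => rho y 0 j)) -> Ck k O h -> Ck k U (fun y => h (rho y)).
Proof.
move=> oU oO UO; elim: k h => [|k IH] h Cr Ch.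
  split=> // x Ux; apply: (@continuous_comp _ _ _ rho h).
    by apply: continuous_rV => a; exact: Ck_continuous (Cr a) Ux.
  by exact: Ck_continuous Ch (UO _ Ux).
split=> [x Ux|].
  apply: (@continuous_comp _ _ _ rho h).
    by apply: continuous_rV => a; exact: Ck_continuous (Cr a) Ux.
  by exact: Ck_continuous Ch (UO _ Ux).
have C1r j : Ck 1 U (fun y => rho y 0 j) by apply: Ck_le (Cr j).
have C1h : Ck 1 O h by apply: Ck_le Ch.
split=> [x Ux i|i]; first by have [] := chain_rule i oU oO Ux (UO _ Ux) C1r C1h.
apply: (@Ck_ext _ _ k U (fun x => \sum_j pderiv j h (rho x) * pderiv i (fun y => rho y 0 j) x)) => //.
  by move=> x Ux; have [] := chain_rule i oU oO Ux (UO _ Ux) C1r C1h.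
apply: Ck_sum => // j _; apply: CkM => //; last exact: Ck_pderiv.
by apply: IH (Ck_pderiv j Ch) => a; exact: Ck_pred.
Qed.

Lemma smooth_open_Ck k (F : 'rV[R]_p -> 'rV[R]_m) U a : open U ->
  smooth_open U F -> Ck k U (fun x => F x 0 a).
Proof.
move=> oU sF.
suff : forall s, Ck k U (fun x => (foldr (@pderiv R p _) F s) x 0 a) by move=> /(_ [::]).
elim: k => [|k IH] s.
  split=> // x Ux; apply: continuous_component; exact: (sF s x Ux).1.
split; first by move=> x Ux; apply: continuous_component; exact: (sF s x Ux).1.
split=> [x Ux i|i]; first by have [] := pderiv_component a ((sF s x Ux).2 i).
apply: Ck_ext (IH (i :: s)) => // x Ux /=.
by have [_] := pderiv_component a ((sF s x Ux).2 i).
Qed.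

End Chain.

Section Schwarz.
Context {R : realType} {m : nat}.
Implicit Types (O : set 'rV[R]_m) (f : 'rV[R]_m -> R).

Lemma derive_shift_arg f (w y v : 'rV[R]_m) :
  derivable f (y + w) v ->
  derivable (fun z => f (z + w)) y v /\ 'D_v (fun z => f (z + w)) y = 'D_v f (y + w).
Proof.
have E : (fun h : R => h^-1 *: (((fun z => f (z + w)) \o shift y) (h *: v) - f (y + w))) =
    (fun h : R => h^-1 *: ((f \o shift (y + w)) (h *: v) - f (y + w))).
  by apply/funext => h /=; rewrite addrA.
by rewrite /derivable /derive E.
Qed.

(** The mean value theorem, first in direction i and then in direction j.  The left-hand side is
    symmetric in i and j, which forces the mixed derivatives to agree. *)
Lemma second_difference O f x (i j : 'I_m) (d s : R) : 0 < s -> 2 * s < d ->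
  ball x d `<=` O -> Ck 2 O f ->
  exists2 y, ball x d y &
   f (x + s *: delta_mx 0 i + s *: delta_mx 0 j) - f (x + s *: delta_mx 0 i)
   - (f (x + s *: delta_mx 0 j) - f x) = s * (s * pderiv j (pderiv i f) y).
Proof.
move=> s0 sd bO Cf.
have inb (a b : R) : 0 <= a <= s -> 0 <= b <= s ->
    ball x d (x + a *: delta_mx 0 i + b *: delta_mx 0 j).
  move=> /andP[a0 sa] /andP[b0 sb]; apply: ball_rV_coord => [|l]; first lra.
  rewrite !mxE /= -addrA addrC addrK (le_lt_trans (ler_normD _ _))//.
  rewrite !normrM (ger0_norm a0) (ger0_norm b0).
  have B (b' : bool) : `|b'%:R : R| <= 1 by case: b'; rewrite ?normr1 ?normr0.
  by apply: (@le_lt_trans _ _ (s * 1 + s * 1)); [apply: lerD; apply: ler_pM|lra].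
have zs : 0 <= (0:R) <= s by rewrite lexx ltW.
have ss : 0 <= s <= s by rewrite lexx ltW.
have inb0 (a : R) : 0 <= a <= s -> ball x d (x + a *: delta_mx 0 i).
  by move=> Ha; have := inb a 0 Ha zs; rewrite scale0r addr0.
pose phi := fun y : 'rV[R]_m => f (y + s *: delta_mx 0 j) - f y.
have dphi (a : R) : 0 <= a <= s -> derivable phi (x + a *: delta_mx 0 i) (delta_mx 0 i) /\
   'D_(delta_mx 0 i) phi (x + a *: delta_mx 0 i) =
   pderiv i f (x + a *: delta_mx 0 i + s *: delta_mx 0 j) - pderiv i f (x + a *: delta_mx 0 i).
  move=> Ha.
  have d1 := @Ck_derivable _ _ _ _ _ _ i Cf (bO _ (inb a s Ha ss)).
  have d2 := @Ck_derivable _ _ _ _ _ _ i Cf (bO _ (inb0 a Ha)).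
  have [d3 E3] := derive_shift_arg d1.
  by split; [exact: derivableB d3 d2|rewrite /phi (deriveB d3 d2) E3].
have [a Ha E] := MVT_line (ltW s0) (fun a Ha => (dphi a Ha).1).
have [b Hb E2] : exists2 b, 0 <= b <= s &
   pderiv i f (x + a *: delta_mx 0 i + s *: delta_mx 0 j) - pderiv i f (x + a *: delta_mx 0 i) =
   s * pderiv j (pderiv i f) (x + a *: delta_mx 0 i + b *: delta_mx 0 j).
  apply: (MVT_line (ltW s0)) => b Hb.
  exact: @Ck_derivable _ _ _ _ _ _ j (Ck_pderiv i Cf) (bO _ (inb a b Ha Hb)).
exists (x + a *: delta_mx 0 i + b *: delta_mx 0 j); first exact: inb.
by rewrite -[LHS]/(phi (x + s *: delta_mx 0 i) - phi x) E (dphi a Ha).2 E2.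
Qed.

Lemma schwarz O f x (i j : 'I_m) : open O -> O x -> Ck 2 O f ->
  pderiv i (pderiv j f) x = pderiv j (pderiv i f) x.
Proof.
move=> oO Ox Cf; apply/eqP/negPn/negP => ne.
set A := pderiv i _ _ in ne; set B := pderiv j _ _ in ne.
pose e := `|A - B| / 2.
have e0 : 0 < e by rewrite divr_gt0// normr_gt0 subr_eq0.
have cA : \forall y \near x, `|A - pderiv i (pderiv j f) y| < e.
  by have /continuous_normP := Ck_continuous (Ck_pderiv i (Ck_pderiv j Cf)) Ox; apply.
have cB : \forall y \near x, `|B - pderiv j (pderiv i f) y| < e.
  by have /continuous_normP := Ck_continuous (Ck_pderiv j (Ck_pderiv i Cf)) Ox; apply.
have /nbhs_ballP[d /= d0 Hd] : \forall y \near x, [/\ O y, `|A - pderiv i (pderiv j f) y| < e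
    & `|B - pderiv j (pderiv i f) y| < e].
  by apply: filterS3 (near_open oO Ox) cA cB; split.
have bO : ball x d `<=` O by move=> y /Hd[].
have s0 : 0 < d / 3 by lra.
have sd : 2 * (d / 3) < d by lra.
have [y1 /Hd[_ _ HB] E1] := second_difference i j s0 sd bO Cf.
have [y2 /Hd[_ HA _] E2] := second_difference j i s0 sd bO Cf.
have cancel (t u v : R) : t != 0 -> t * (t * u) = t * (t * v) -> u = v.
  by move=> t0 /(mulfI t0)/(mulfI t0).
have E : pderiv i (pderiv j f) y2 = pderiv j (pderiv i f) y1.
  apply: (cancel _ _ _ (lt0r_neq0 s0)); apply: (etrans (esym E2)); apply: etrans E1.
  rewrite -!addrA (addrC (_ *: delta_mx 0 j) (_ *: delta_mx 0 i)) !opprD !opprK.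
  by move: (f _) (f _) (f _) (f _) => u v w z; ring.
have tri (a b u : R) : `|a - u| < e -> `|b - u| < e -> `|a - b| < e + e.
  move=> au bu; rewrite (_ : a - b = (a - u) - (b - u)); last by ring.
  by apply: (le_lt_trans (ler_normB _ _)); exact: ltrD.
rewrite E in HA; have := tri _ _ _ HA HB.
by rewrite -mulr2n -[e *+ 2]mulr_natr divfK ?ltxx// pnatr_eq0.
Qed.

Lemma Ck_sqrt k O f : open O -> (forall x, O x -> 0 < f x) -> Ck k O f ->
  Ck k O (fun x => Num.sqrt (f x)).
Proof.
move=> oO f0.
have cs x g : Ck 0 O g -> O x -> {for x, continuous (fun x => Num.sqrt (g x))}.
  by move=> Cg Ox; apply: continuous_comp (Ck_continuous Cg Ox) _; exact: sqrt_continuous.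
elim: k => [|k IH] Cf; first by split => // x Ox; exact: cs.
have dE x i : O x -> is_derive x (delta_mx 0 i) (fun x => Num.sqrt (f x))
    ((2 * Num.sqrt (f x))^-1 * pderiv i f x).
  move=> Ox; apply: (chain_rule_scalar oO i _ Ox (is_derive1_sqrt (f0 x Ox))).
  exact: Ck_le Cf.
split; first by move=> x Ox; apply: cs => //; exact: (Ck_le (leq0n k.+1) Cf).
split=> [x Ox i|i]; first by have [] := dE x i Ox.
have C2 : Ck k O (fun x => (2 * Num.sqrt (f x))^-1).
  apply: CkV => // [x Ox|]; first by rewrite mulf_neq0 ?pnatr_eq0// gt_eqF// sqrtr_gt0 f0.
  by apply: CkM => //; [exact: Ck_cst|exact: IH (Ck_pred Cf)].
apply: Ck_ext (CkM oO C2 (Ck_pderiv i Cf)) => // x Ox.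
by have [_] := dE x i Ox.
Qed.

End Schwarz.

(** * A compactly supported field cannot have a nonnegative nonzero divergence *)

Section Grid.
Context {R : realType} {m : nat}.
Implicit Types (x y : 'rV[R]_m).

Lemma compact_unif_cont (Q : set 'rV[R]_m) (g : 'rV[R]_m -> R) (e : R) :
  compact Q -> continuous g -> 0 < e ->
  exists2 d, 0 < d & forall x y, Q x -> ball x d y -> `|g x - g y| < e.
Proof.
move=> /compact_near_coveringP cQ cg e0.
have : \forall d \near 0^'+, Q `<=` [set x | forall y, ball x d y -> `|g x - g y| < e].
  apply: cQ => x Qx.
  have e20 : 0 < e / 2 by rewrite divr_gt0.
  have /continuous_normP/(_ _ e20)/nbhs_ballP[r /= r0 Hr] := cg x.
  exists (ball x (r / 2), [set d | 0 < d < r / 2]).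
    split; first by apply: nbhsx_ballx; rewrite divr_gt0.
    by near=> d; apply/andP; split=> //; near: d; apply: nbhs_right_lt; rewrite divr_gt0.
  move=> [x' d] [/= xx' /andP[d0 dr]] y x'y.
  have xy : ball x r y.
    by rewrite (splitr r); apply: ball_triangle xx' _; apply: le_ball x'y; exact: ltW.
  have {}xx' : ball x r x' by apply: le_ball xx'; rewrite ler_pdivrMr// ler_pMr// ler1n.
  rewrite (_ : g x' - g y = (g x - g y) - (g x - g x')); last by ring.
  by rewrite (le_lt_trans (ler_normB _ _))// (splitr e) ltrD//; exact: Hr.
move=> H; near (0 : R)^'+ => d.
exists d => //.
by move=> x y Qx; apply: (near H d).
Unshelve. all: by end_near. Qed.


(** On each line of the grid in direction i the increments telescope, and u vanishes at both ends
    of the line.  This is expressed as the invariance of the sum under the cyclic shift of the i-th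
    index: at the last point of a line, both the shifted value and the value it is compared with
    are zero. *)
Lemma grid_increments_eq0 (u : 'rV[R]_m -> R) (x0 : 'rV[R]_m) (L : R) (N : nat) (i : 'I_m) :
  (0 < N)%N -> (forall x, `|x 0 i - x0 0 i| = L -> u x = 0) -> 0 <= L ->
  let h := 2 * L / N%:R in
  let X (J : {ffun 'I_m -> 'I_N}) := \row_j (x0 0 j - L + h * (J j)%:R) in
  \sum_J (u (X J + h *: delta_mx 0 i) - u (X J)) = 0.
Proof.
move=> N0 u0 L0 h X.
have hN : h * N%:R = 2 * L by rewrite divfK// pnatr_eq0 -lt0n.
pose sh (J : {ffun 'I_m -> 'I_N}) : {ffun 'I_m -> 'I_N} :=
  [ffun j => if j == i then ordS (J j) else J j].
have sh_inj : injective sh.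
  move=> J J' /ffunP E; apply/ffunP => j; move: (E j); rewrite !ffunE.
  by case: ifP => // _ /ordS_inj.
(* compare the shifted value at J with the value at the cyclic successor of J *)
rewrite sumrB [X in _ - X](reindex_inj sh_inj) /= -sumrB big1// => J _.
have [lt|ge] := ltnP (J i).+1 N.
  suff -> : X J + h *: delta_mx 0 i = X (sh J) by rewrite subrr.
  apply/rowP => j; rewrite !mxE !ffunE eqxx /=; case: eqP => [->|_]; last by rewrite mulr0 addr0.
  by rewrite /= modn_small// -[(J i).+1%:R]natr1 mulrDr addrA.
have JN : (J i).+1 = N by apply/eqP; rewrite eqn_leq ltn_ord ge.
have NR : N%:R = (J i)%:R + 1 :> R by rewrite natr1 JN.
rewrite !u0 ?subrr//.
  rewrite !mxE !ffunE eqxx /= JN modnn mulr0 addr0 addrAC subrr add0r normrN ger0_norm//.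
rewrite !mxE !eqxx /= (_ : _ - _ = h * ((J i)%:R + 1) - L); last by ring.
by rewrite -NR hN (_ : _ - _ = L) ?ger0_norm//; ring.
Qed.

(** The integral of a divergence is zero.  The sum of the increments over a regular grid centred at
    x0 vanishes; by the mean value theorem and uniform continuity it is the mesh times the sum of
    the divergence, up to an error e at each point and in each direction.  If the divergence were
    positive at x0, the grid points of one orthant close to x0, which are a fixed proportion of
    the grid, would outweigh these errors. *)
Lemma compact_support_divergence (U : 'I_m -> 'rV[R]_m -> R) (x0 : 'rV[R]_m) (L : R) :
  0 < L ->
  (forall i x, derivable (U i) x (delta_mx 0 i)) ->
  (forall i, continuous (pderiv i (U i))) ->
  (forall i x, `|x 0 i - x0 0 i| = L -> U i x = 0) ->
  (forall x, 0 <= \sum_i pderiv i (U i) x) ->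
  \sum_i pderiv i (U i) x0 = 0.
Proof.
move=> L0 dU cU U0 D0.
pose D x := \sum_i pderiv i (U i) x.
apply/eqP; rewrite eq_le D0 andbT leNgt; apply/negP => Dx0.
have cD : continuous D.
  by apply: (@continuous_big _ _ +%R) => [|i _]; [exact: add_continuous|exact: cU].
pose c := D x0 / 2.
have c0 : 0 < c by rewrite divr_gt0.
have [d d0 Hd] : exists2 d, 0 < d & forall y, ball x0 d y -> c < D y.
  have /continuous_normP/(_ _ c0)/nbhs_ballP[d /= d0 Hd] := cD x0.
  exists d => // y /Hd; rewrite ltr_norml => /andP[_].
  by rewrite /c; lra.
have archi (r t : R) : 0 < t -> exists K : nat, 0 < K%:R :> R /\ r / K%:R < t.
  move=> t0; exists (Num.truncn (r / t)).+1; split; first by rewrite ltr0n.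
  by rewrite ltr_pdivrMr ?ltr0n// [t * _]mulrC -ltr_pdivrMr// truncnS_gt.
have [K [K0 LK]] := archi L d d0.
have nK0 : (0 < K)%N by rewrite -(ltr0n R).
pose e := c / (m.+1%:R * ((2 * K) ^ m)%:R).
have P0 : 0 < ((2 * K) ^ m)%:R :> R by rewrite ltr0n expn_gt0 muln_gt0 nK0.
have e0 : 0 < e by rewrite divr_gt0// mulr_gt0// ltr0n.
pose Q := [set x : 'rV[R]_m | forall i, (x 0 i) \in `[x0 0 i - L, x0 0 i + L]].
have cQ : compact Q.
  apply: (@rV_compact _ _ (fun i => `[x0 0 i - L, x0 0 i + L]%classic)) => i.
  exact: segment_compact.
have [d' d'0 Hd'] : exists2 d', 0 < d' & forall i x y, Q x -> ball x d' y ->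
    `|pderiv i (U i) x - pderiv i (U i) y| < e.
  have /choice[dl Hdl] i : exists d', 0 < d' /\ forall x y, Q x -> ball x d' y ->
      `|pderiv i (U i) x - pderiv i (U i) y| < e.
    by have [d' d'0 H] := compact_unif_cont cQ (cU i) e0; exists d'.
  exists (\big[Num.min/1]_i dl i).
    by apply: lt_bigmin => // i _; exact: (Hdl i).1.
  move=> i x y Qx xy; apply: (Hdl i).2 => //; apply: le_ball xy.
  exact: bigmin_le_cond.
have [M [M0 hd'M]] := archi (L / K%:R) d' d'0.
pose N := (2 * K * M)%N.
have nM0 : (0 < M)%N by rewrite -(ltr0n R).
have N0 : (0 < N)%N by rewrite !muln_gt0 nK0 nM0.
pose h := 2 * L / N%:R.
have hE : h = L / K%:R / M%:R.
  rewrite /h /N !natrM; field.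
  by rewrite ?mulf_neq0 ?(gt_eqF M0) ?(gt_eqF K0).
have h0 : 0 < h by rewrite hE !divr_gt0.
have hd' : h < d' by rewrite hE.
have hM : h * M%:R = L / K%:R by rewrite hE divfK ?gt_eqF.
have hKM : h * (K * M)%:R = L by rewrite natrM mulrC -mulrA [_ * h]mulrC hM mulrC divfK ?gt_eqF.
pose X (J : {ffun 'I_m -> 'I_N}) : 'rV[R]_m := \row_j (x0 0 j - L + h * (J j)%:R).
have QX J : Q (X J).
  move=> i; rewrite mxE in_itv/=; apply/andP; split.
    by rewrite lerDl mulr_ge0// ltW.
  have : h * (J i)%:R <= 2 * L.
    rewrite -[leRHS](_ : h * N%:R = _); last by rewrite divfK// pnatr_eq0 -lt0n.
    by rewrite ler_pM2l// ler_nat ltnW.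
  by lra.
have inc J i : exists2 q, ball (X J) d' q & U i (X J + h *: delta_mx 0 i) - U i (X J) = h * pderiv i (U i) q.
  have [s /andP[s0 sh] E] := MVT_line (ltW h0) (fun s _ => dU i (X J + s *: delta_mx 0 i)).
  exists (X J + s *: delta_mx 0 i) => //; apply: ball_rV_coord => // j.
  rewrite !mxE eqxx /= addrAC subrr add0r normrM (ger0_norm s0).
  by case: (j == i); rewrite ?mulr1 ?mulr0 ?normr1 ?normr0 ?mulr1 ?mulr0//; exact: le_lt_trans hd'.
have inc' J i : h * (pderiv i (U i) (X J) - e) <= U i (X J + h *: delta_mx 0 i) - U i (X J).
  have [q Xq ->] := inc J i; rewrite ler_pM2l//.
  by have := Hd' i _ _ (QX J) Xq; rewrite ltr_norml => /andP[_]; lra.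
have S0 : \sum_J \sum_i (pderiv i (U i) (X J) - e) <= 0.
  rewrite -(pmulr_rle0 _ h0) exchange_big /= mulr_sumr sumr_le0// => i _.
  rewrite -[leRHS](grid_increments_eq0 N0 (U0 i) (ltW L0)) mulr_sumr.
  exact: ler_sum.
have S1 : \sum_J D (X J) <= (N ^ m)%:R * (m%:R * e).
  rewrite -subr_le0 (le_trans _ S0)// le_eqVlt; apply/orP; left; apply/eqP.
  under [RHS]eq_bigr do rewrite sumrB.
  rewrite sumrB; congr (_ - _).
  by rewrite !sumr_const card_ffun !card_ord mulrA -natrM mulr_natl -mulrnA mulnC.
have AKM (l : 'I_M) : (K * M + l < N)%N.
  by rewrite /N -mulnA mul2n -addnn ltn_add2l (leq_trans (ltn_ord l))// leq_pmull.
(* indices K M, ..., K M + M - 1 out of 2 K M: the coordinates within L / K above those of x0 *)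
pose A := [set Ordinal (AKM l) | l : 'I_M].
have cardA : #|A| = M.
  rewrite card_imset ?card_ord// => l l' /(congr1 val)/= /eqP.
  by rewrite eqn_add2l => /eqP/val_inj.
have DX0 J : 0 <= D (X J) by exact: D0.
have S2 : (M ^ m)%:R * c <= \sum_J D (X J).
  rewrite (bigID [pred J | J \in ffun_on A])/= -[leLHS]addr0 lerD ?sumr_ge0//.
  apply: (@le_trans _ _ (\sum_(J : {ffun 'I_m -> 'I_N} | J \in ffun_on A) c)).
    by rewrite sumr_const card_ffun_on cardA card_ord mulr_natl.
  apply: ler_sum => J /ffun_onP JA; apply/ltW/Hd/ball_rV_coord => // j.
  have /imsetP[l _ Jl] := JA j.
  rewrite mxE Jl /= natrD mulrDr hKM [X in `|X|](_ : _ = h * l%:R); last by ring.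
  rewrite (ger0_norm (mulr_ge0 (ltW h0) (ler0n _ _))); apply: le_lt_trans LK.
  by rewrite -hM ler_pM2l// ler_nat ltnW.
have E : (N ^ m)%:R * (m%:R * e) = (M ^ m)%:R * (c * (m%:R / m.+1%:R)).
  have cancelP (P q a b r : R) : P != 0 -> q != 0 -> P * a * (b * (r / (q * P))) = a * (r * (b / q)).
    by move=> ? ?; field; apply/andP.
  by rewrite /N expnMn natrM cancelP ?gt_eqF// ltr0n.
have := le_trans S2 S1; apply/negP; rewrite -ltNge E.
rewrite ltr_pM2l ?ltr0n ?expn_gt0 ?nM0// -[ltRHS]mulr1 ltr_pM2l//.
by rewrite ltr_pdivrMr ?ltr0n// mul1r ltr_nat.
Qed.
End Grid.

(** * Linear algebra of the leaf directions *)

Section LinAlg.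
Context {R : realFieldType}.

Lemma sum_sqr_eq0 (I : finType) (f : I -> R) : \sum_i f i ^+ 2 = 0 -> forall i, f i = 0.
Proof.
move=> H i; apply/eqP; rewrite -sqrf_eq0; apply/eqP.
have /psumr_eq0P -> // : \sum_i f i ^+ 2 = 0 by [].
by move=> j _; exact: sqr_ge0.
Qed.

Lemma cauchy_schwarz (I : finType) (f g : I -> R) :
  (\sum_i f i * g i) ^+ 2 <= (\sum_i f i ^+ 2) * (\sum_i g i ^+ 2).
Proof.
set a := \sum_i f i ^+ 2; set b := \sum_i g i ^+ 2; set c := \sum_i _.
have b0 : 0 <= b by apply: sumr_ge0 => i _; exact: sqr_ge0.
have : 0 <= \sum_i (b * f i - c * g i) ^+ 2 by apply: sumr_ge0 => i _; exact: sqr_ge0.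
have -> : \sum_i (b * f i - c * g i) ^+ 2 = b * (a * b - c ^+ 2).
  transitivity (b ^+ 2 * a - 2 * b * c * c + c ^+ 2 * b); last by ring.
  have -> : b ^+ 2 * a = \sum_i b ^+ 2 * f i ^+ 2 by rewrite mulr_sumr.
  have -> : 2 * b * c * c = \sum_i 2 * b * c * (f i * g i) by rewrite -mulr_sumr.
  have -> : c ^+ 2 * b = \sum_i c ^+ 2 * g i ^+ 2 by rewrite mulr_sumr.
  by rewrite -sumrB -big_split /=; apply: eq_bigr => i _; ring.
have [b00|bN0] := eqVneq b 0.
  move=> _; have g0 := sum_sqr_eq0 b00.
  by rewrite /c big1 ?expr0n ?b00 ?mulr0// => i _; rewrite g0 mulr0.
by rewrite pmulr_rge0 ?subr_ge0// lt_neqAle eq_sym bN0.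
Qed.

Lemma mxtrace_mulmxE m (A B : 'M[R]_m) : \tr (A *m B) = \sum_i \sum_j A i j * B j i.
Proof. by rewrite /mxtrace; apply: eq_bigr => i _; rewrite mxE. Qed.

Lemma mxtrace_mul_tr m (A : 'M[R]_m) : \tr (A *m A^T) = \sum_ij A ij.1 ij.2 ^+ 2.
Proof.
rewrite mxtrace_mulmxE pair_big /=; apply: eq_bigr => -[i j] _ /=.
by rewrite mxE expr2.
Qed.

Lemma mxtrace_mul_tr_eq0 m (A : 'M[R]_m) : \tr (A *m A^T) = 0 -> A = 0.
Proof.
rewrite mxtrace_mul_tr => /sum_sqr_eq0 H; apply/matrixP => i j.
by rewrite (H (i, j)) mxE.
Qed.

(** tr C^3 is the Frobenius product of C^2 and C, and the Frobenius norm, whose square is tr C^2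
    for symmetric C, is submultiplicative. *)
Lemma symmetric_trace_cube m (C : 'M[R]_m) : C^T = C ->
  0 <= \tr (C *m C) /\ \tr (C *m C *m C) ^+ 2 <= \tr (C *m C) ^+ 3.
Proof.
move=> Cs.
have t2E : \tr (C *m C) = \sum_ij C ij.1 ij.2 ^+ 2 by rewrite -mxtrace_mul_tr Cs.
have t20 : 0 <= \tr (C *m C) by rewrite t2E; apply: sumr_ge0 => ij _; exact: sqr_ge0.
split=> //.
have E3 : \tr (C *m C *m C) = \sum_ij (C *m C) ij.1 ij.2 * C ij.1 ij.2.
  rewrite mxtrace_mulmxE pair_big /=; apply: eq_bigr => -[i j] _ /=.
  by rewrite -[in X in _ * X]Cs [C^T j i]mxE.
have t2r : \tr (C *m C) = \sum_i \sum_j C i j ^+ 2 by rewrite t2E pair_big.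
have t2c : \tr (C *m C) = \sum_j \sum_i C i j ^+ 2 by rewrite exchange_big.
have F4 : \sum_ij (C *m C) ij.1 ij.2 ^+ 2 <= \tr (C *m C) ^+ 2.
  rewrite expr2 [X in X * _]t2r t2c mulr_suml.
  rewrite -(pair_big xpredT xpredT (fun i j => (C *m C) i j ^+ 2)) /=.
  apply: ler_sum => i _; rewrite mulr_sumr; apply: ler_sum => j _.
  by rewrite mxE; exact: cauchy_schwarz.
rewrite E3; apply: le_trans (cauchy_schwarz _ _) _.
by rewrite -t2E exprSr ler_wpM2r.
Qed.

Lemma row_mulC m (u v : 'rV[R]_m) : u *m v^T = v *m u^T.
Proof. by rewrite -[RHS]trmxK trmx_mul trmxK; apply/matrixP => i j; rewrite !ord1 [RHS]mxE. Qed.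

(** The difference Q of the two sides is killed by all vectors of the frame, hence idempotent; it is
    symmetric, and its trace is (n + 2) - n - 1 - 1 = 0.  So the Frobenius norm of Q is zero. *)
Lemma frame_resolution n (J : 'M[R]_(n, n.+2)) (N p : 'rV[R]_n.+2) :
  J *m J^T \in unitmx -> J *m N^T = 0 -> J *m p^T = 0 ->
  N *m N^T = 1%:M -> p *m p^T = 1%:M -> N *m p^T = 0 ->
  J^T *m invmx (J *m J^T) *m J = 1%:M - N^T *m N - p^T *m p.
Proof.
move=> gu JN Jp NN pp Np.
set g := J *m J^T; set P := J^T *m invmx g *m J.
pose Q := 1%:M - N^T *m N - p^T *m p - P.
have NJ : N *m J^T = 0 by rewrite -[N]trmxK -trmx_mul JN trmx0.
have pJ : p *m J^T = 0 by rewrite -[p]trmxK -trmx_mul Jp trmx0.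
have pN : p *m N^T = 0 by rewrite row_mulC.
have JQ : J *m Q = 0.
  rewrite /Q !mulmxBr mulmx1 !mulmxA JN Jp !mul0mx !subr0.
  by rewrite mulmxV// mul1mx subrr.
have NQ : N *m Q = 0.
  by rewrite /Q !mulmxBr mulmx1 !mulmxA NN Np NJ !mul0mx mul1mx !subr0 subrr.
have pQ : p *m Q = 0.
  by rewrite /Q !mulmxBr mulmx1 !mulmxA pN pp pJ !mul0mx mul1mx !subr0 subrr.
have QQ : Q *m Q = Q.
  by rewrite {1}/Q !mulmxBl mul1mx -!mulmxA NQ pQ JQ !mulmx0 !subr0.
have gs : g^T = g by rewrite trmx_mul trmxK.
have Qs : Q^T = Q.
  by rewrite /Q !linearB /= trmx1 /P !trmx_mul !trmxK trmx_inv gs !mulmxA.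
have trQ : \tr Q = 0.
  have trP : \tr P = n%:R by rewrite /P -mulmxA mxtrace_mulC -mulmxA mulVmx// mxtrace1.
  rewrite /Q !linearB /= mxtrace1 trP.
  rewrite [\tr (N^T *m _)]mxtrace_mulC NN [\tr (p^T *m _)]mxtrace_mulC pp !mxtrace1.
  by rewrite -[n.+2%:R]natr1 -[n.+1%:R]natr1; ring.
have Q0 : Q = 0 by apply: mxtrace_mul_tr_eq0; rewrite Qs QQ.
by apply/esym/subr0_eq.
Qed.

(** For the splitting of the space into N, the range of P and x, the matrix D is block triangular
    with zero diagonal blocks on N and on x.  Compressing it by P therefore keeps the traces of its
    powers. *)
Lemma homogeneous_traces m (D P : 'M[R]_m) (N x : 'rV[R]_m) (rho2 : R) :
  rho2 != 0 -> D *m N^T = 0 -> x *m D = 0 -> D *m x^T = - N^T ->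
  N *m N^T = 1%:M -> N *m x^T = 0 ->
  P = 1%:M - N^T *m N - rho2^-1 *: (x^T *m x) ->
  [/\ P *m D *m P = P *m D, P *m D *m P *m D = P *m D *m D,
   \tr (P *m D) = \tr D, \tr (P *m D *m D) = \tr (D *m D)
   & \tr (P *m D *m D *m D) = \tr (D *m D *m D)].
Proof.
move=> r0 DN xD Dx NN Nx PE.
have xN : x *m N^T = 0 by rewrite row_mulC.
have PN : P *m N^T = 0.
  by rewrite PE !mulmxBl -scalemxAl mul1mx -!mulmxA NN xN !mulmx0 mulmx1 scaler0 subr0 subrr.
have PDP : P *m D *m P = P *m D.
  rewrite {2}PE !mulmxBr mulmx1 !mulmxA -[P *m D *m N^T]mulmxA DN mulmx0 mul0mx subr0.
  by rewrite -scalemxAr !mulmxA -[P *m D *m x^T]mulmxA Dx mulmxN PN oppr0 mul0mx scaler0 subr0.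
have trP (E : 'M[R]_m) : D *m E *m N^T = 0 -> \tr (P *m (D *m E)) = \tr (D *m E).
  move=> EN; rewrite PE !mulmxBl mul1mx -scalemxAl -![_ *m _ *m (D *m E)]mulmxA.
  rewrite [x *m _]mulmxA xD mul0mx mulmx0 scaler0 subr0 linearB /= [\tr (N^T *m _)]mxtrace_mulC.
  by rewrite -mulmxA EN mulmx0 linear0 subr0.
split; rewrite ?PDP//.
- by have := trP 1%:M; rewrite mulmx1; apply.
- by have := trP D; rewrite !mulmxA; apply; rewrite -mulmxA DN mulmx0.
- by have := trP (D *m D); rewrite !mulmxA; apply; rewrite -mulmxA DN mulmx0.
Qed.

End LinAlg.

(** * Gauss equation in coordinates *)

Section CkMatrix.
Context {R : realType} {m : nat} (O : set 'rV[R]_m) (oO : open O).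

Lemma Ck_det k q (M : 'rV[R]_m -> 'M[R]_q) :
  (forall i j, Ck k O (fun x => M x i j)) -> Ck k O (fun x => \det (M x)).
Proof.
move=> CM; apply: Ck_sum => // s _; apply: CkM => //; first exact: Ck_cst.
by apply: Ck_prod => // i _; exact: CM.
Qed.

Lemma Ck_invmx k q (M : 'rV[R]_m -> 'M[R]_q) i j :
  (forall x, O x -> M x \in unitmx) ->
  (forall i j, Ck k O (fun x => M x i j)) -> Ck k O (fun x => invmx (M x) i j).
Proof.
move=> Mu CM.
have Cadj : Ck k O (fun x => \adj (M x) i j).
  apply: (@Ck_ext _ _ k O (fun x => (-1) ^+ (j + i) * \det (row' j (col' i (M x))))) => //.
    by move=> x Ox; rewrite mxE.
  apply: CkM => //; first exact: Ck_cst.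
  apply: Ck_det => a b; apply: Ck_ext (CM (lift j a) (lift i b)) => // x Ox.
  by rewrite !mxE.
apply: (@Ck_ext _ _ k O (fun x => (\det (M x))^-1 * \adj (M x) i j)) => //.
  by move=> x Ox; rewrite /invmx Mu// [RHS]mxE.
apply: CkM => //; apply: CkV => //; last exact: Ck_det.
by move=> x /Mu; rewrite unitmxE unitfE.
Qed.

Lemma pderiv_dot q (u v : 'I_q -> 'rV[R]_m -> R) i x : O x ->
  (forall a, Ck 1 O (u a)) -> (forall a, Ck 1 O (v a)) ->
  pderiv i (fun y => \sum_a u a y * v a y) x =
  \sum_a pderiv i (u a) x * v a x + \sum_a u a x * pderiv i (v a) x.
Proof.
move=> Ox Cu Cv.
have duv a : derivable (fun y => u a y * v a y) x (delta_mx 0 i).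
  by apply: derivableM; [exact: Ck_derivable (Cu a) Ox|exact: Ck_derivable (Cv a) Ox].
rewrite /pderiv (_ : (fun y => _) = \sum_a (fun y => u a y * v a y)); last first.
  by apply/funext => y; rewrite fct_sumE.
rewrite derive_sum// -big_split /=; apply: eq_bigr => a _.
by apply: pderivM; [exact: Ck_derivable (Cu a) Ox|exact: Ck_derivable (Cv a) Ox].
Qed.

Lemma pderiv_dot_cst q (u v : 'I_q -> 'rV[R]_m -> R) (c : R) i x : O x ->
  (forall a, Ck 1 O (u a)) -> (forall a, Ck 1 O (v a)) ->
  (forall y, O y -> \sum_a u a y * v a y = c) ->
  \sum_a pderiv i (u a) x * v a x = - \sum_a u a x * pderiv i (v a) x.
Proof.
move=> Ox Cu Cv uvc; apply/eqP; rewrite -addr_eq0 -pderiv_dot//.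
by rewrite (eq_pderiv i oO Ox uvc) pderiv_cst.
Qed.

End CkMatrix.

(** Koszul's formula for the Christoffel symbols involves six sums over the coordinates of the
    ambient space. *)
Lemma merge_six_sums (R : fieldType) (I : finType) (t c : R) (u1 u2 u3 u4 u5 u6 w : I -> R) :
  (forall a, t * (c * (u1 a + u2 a + (u3 a + u4 a) - (u5 a + u6 a))) = w a) ->
  t * (c * (\sum_a u1 a + \sum_a u2 a + (\sum_a u3 a + \sum_a u4 a)
            - (\sum_a u5 a + \sum_a u6 a))) = \sum_a w a.
Proof.
move=> uw; rewrite -(big_split _ _ _ u1) -(big_split _ _ _ u3) -(big_split _ _ _ u5) /=.
rewrite -(big_split _ _ _ (fun a => u1 a + u2 a)) /= -sumrB !mulr_sumr.
by apply: eq_bigr => a _; exact: uw.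
Qed.

(** The double trace of the curvature tensor in Gauss's form: g and h stand for the two fundamental
    forms, G for the inverse of g, and S for the shape operator. *)
Lemma scalar_contraction (R : comPzRingType) n (G g h : 'M[R]_n) :
  G *m g = 1%:M -> h^T = h -> g^T = g -> let S := G *m h in
  \sum_j \sum_k G j k * \sum_i (S i i * h j k - S i j * h i k
      + (i == i)%:R * g j k - (i == j)%:R * g i k)
  = n%:R * (n%:R - 1) + (\tr S) ^+ 2 - \tr (S *m S).
Proof.
move=> Gg hs gs S.
pose M := \tr S *: h - S^T *m h + (n%:R - 1) *: g.
have ME j k : \sum_i (S i i * h j k - S i j * h i k + (i == i)%:R * g j k - (i == j)%:R * g i k) = M j k.
  rewrite sumrB big_split /= sumrB !mxE mulr_suml mulrBl mul1r addrA.
  congr (_ - _ + _ - _).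
  - by apply: eq_bigr => i _; rewrite [S^T j i]mxE.
  - under eq_bigr do rewrite eqxx mul1r.
    by rewrite sumr_const card_ord mulr_natl.
  - by rewrite (bigD1 j)//= eqxx mul1r big1 ?addr0// => i /negPf->; rewrite mul0r.
transitivity (\tr (G *m M^T)).
  apply: eq_bigr => j _; rewrite mxE; apply: eq_bigr => k _.
  by rewrite ME [in RHS]mxE.
have -> : M^T = \tr S *: h - h *m S + (n%:R - 1) *: g.
  by rewrite /M linearD linearB /= !linearZ /= trmx_mul trmxK hs gs.
have -> : G *m (\tr S *: h - h *m S + (n%:R - 1) *: g) = \tr S *: S - S *m S + (n%:R - 1)%:M.
  by rewrite mulmxDr mulmxBr -!scalemxAr Gg mulmxA scalemx1.
rewrite linearD linearB /= linearZ /= mxtrace_scalar.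
by rewrite expr2 addrC addrA [n%:R * _]mulrC mulr_natr.
Qed.

Section Gauss.
Context {R : realType} {n : nat}.
Variables (F V : 'I_n.+2 -> 'rV[R]_n -> R) (O : set 'rV[R]_n) (g : 'rV[R]_n -> 'M[R]_n).
Hypothesis oO : open O.
Hypothesis Cf : forall a, Ck 3 O (F a).
Hypothesis Cnu : forall a, Ck 1 O (V a).
Hypothesis ff : forall x, O x -> \sum_a F a x * F a x = 1.
Hypothesis nn : forall x, O x -> \sum_a V a x * V a x = 1.
Hypothesis nf : forall x, O x -> \sum_a V a x * F a x = 0.
Hypothesis nt : forall x, O x -> forall i, \sum_a V a x * pderiv i (F a) x = 0.
Hypothesis gE : forall x, O x -> forall i j, g x i j = \sum_a pderiv i (F a) x * pderiv j (F a) x.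
Hypothesis gu : forall x, O x -> g x \in unitmx.

Definition tangent_mx (x : 'rV[R]_n) : 'M[R]_(n, n.+2) := \matrix_(i, a) pderiv i (F a) x.
Definition normal_mx (x : 'rV[R]_n) : 'M[R]_(n, n.+2) := \matrix_(i, a) pderiv i (V a) x.

Let Cf1 i a : Ck 2 O (pderiv i (F a)) := Ck_pderiv i (Cf a).
Let Cf2 i j a : Ck 1 O (pderiv i (pderiv j (F a))) := Ck_pderiv i (Cf1 j a).

(** The tangent vectors dual to the coordinate vectors.  Writing the Christoffel symbols as products
    of these with the second derivatives of F (Gam below) leaves only first derivatives of the dual
    vectors in the curvature: the third derivatives of F cancel by symmetry. *)
Let dual k a x := \sum_q invmx (g x) k q * pderiv q (F a) x.

Let Cdual k a : Ck 1 O (dual k a).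
Proof.
apply: Ck_sum => // q _; apply: CkM => //; last exact: Ck_pred (Cf1 q a).
apply: Ck_invmx => // i j.
apply: (@Ck_ext _ _ _ _ (fun x => \sum_a pderiv i (F a) x * pderiv j (F a) x)) => //.
  by move=> x Ox; rewrite gE.
by apply: Ck_sum => // b _; apply: CkM => //; exact: Ck_pred.
Qed.

Let metricE x : O x -> g x = tangent_mx x *m (tangent_mx x)^T.
Proof. by move=> Ox; apply/matrixP => i j; rewrite gE// mxE; apply: eq_bigr => a _; rewrite !mxE. Qed.

Let g_sym x i j : O x -> g x i j = g x j i.
Proof. by move=> Ox; rewrite (gE Ox i j) (gE Ox j i); apply: eq_bigr => a _; rewrite mulrC. Qed.

Let ginv_sym x i j : O x -> invmx (g x) i j = invmx (g x) j i.
Proof.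
move=> Ox; have gs : (g x)^T = g x by apply/matrixP => a b; rewrite mxE g_sym.
by rewrite -[in LHS]gs -trmx_inv mxE.
Qed.

Let tangent_pos x i : O x -> \sum_a pderiv i (F a) x * F a x = 0.
Proof.
move=> Ox; have C1f a := Ck_le (isT : (1 <= 3)%N) (Cf a).
have := pderiv_dot_cst oO i Ox C1f C1f ff.
rewrite [X in - X](eq_bigr (fun a => pderiv i (F a) x * F a x)); last by move=> a _; rewrite mulrC.
by move=> E; lra.
Qed.

Let C1f a : Ck 1 O (F a). Proof. exact: Ck_le (Cf a). Qed.
Let C1f1 i a : Ck 1 O (pderiv i (F a)). Proof. exact: Ck_pred. Qed.

Let dual_tangent x l p : O x -> \sum_a dual l a x * pderiv p (F a) x = (l == p)%:R.
Proof.
move=> Ox; transitivity ((invmx (g x) *m g x) l p); last by rewrite mulVmx ?gu// mxE.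
rewrite mxE; under eq_bigr do rewrite mulr_suml.
rewrite exchange_big /=; apply: eq_bigr => q _.
by rewrite gE// mulr_sumr; apply: eq_bigr => a _; rewrite mulrA.
Qed.

Let dual_orth x l (u : 'I_n.+2 -> R) : (forall i, \sum_a u a * pderiv i (F a) x = 0) ->
  \sum_a dual l a x * u a = 0.
Proof.
move=> H; under eq_bigr do rewrite mulr_suml.
rewrite exchange_big /= big1// => q _.
transitivity (invmx (g x) l q * \sum_a u a * pderiv q (F a) x); last by rewrite H mulr0.
by rewrite mulr_sumr; apply: eq_bigr => a _; ring.
Qed.

Let dual_nu x l : O x -> \sum_a dual l a x * V a x = 0.
Proof. by move=> Ox; apply: dual_orth => i; exact: nt. Qed.

Let dual_pos x l : O x -> \sum_a dual l a x * F a x = 0.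
Proof.
move=> Ox; apply: dual_orth => i; rewrite -[RHS](tangent_pos i Ox).
by apply: eq_bigr => a _; rewrite mulrC.
Qed.

Let Gam l i j x := \sum_a dual l a x * pderiv i (pderiv j (F a)) x.

Let christoffelE x l i j : O x -> christoffel g l i j x = Gam l i j x.
Proof.
move=> Ox; rewrite /christoffel.
have dg i' j' k : pderiv k (fun y => g y i' j') x =
   \sum_a pderiv k (pderiv i' (F a)) x * pderiv j' (F a) x
   + \sum_a pderiv i' (F a) x * pderiv k (pderiv j' (F a)) x.
  rewrite -(@pderiv_dot _ _ O _ (fun a => pderiv i' (F a)) (fun a => pderiv j' (F a)) k x Ox
    (C1f1 i') (C1f1 j')).
  by apply: (eq_pderiv _ oO Ox) => y Oy; exact: gE.
have S a i' j' : pderiv i' (pderiv j' (F a)) x = pderiv j' (pderiv i' (F a)) x.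
  by rewrite (schwarz i' j' oO Ox (Ck_pred (Cf a))).
rewrite /Gam /dual; under [RHS]eq_bigr do rewrite mulr_suml.
rewrite exchange_big /= mulr_sumr; apply: eq_bigr => q _.
rewrite (dg j q i) (dg i q j) (dg i j q).
pose D1 i a := pderiv i (F a) x; pose D2 i j a := pderiv i (pderiv j (F a)) x.
rewrite -[LHS]/(2^-1 * (invmx (g x) l q * (\sum_a D2 i j a * D1 q a + \sum_a D1 j a * D2 i q a
  + (\sum_a D2 j i a * D1 q a + \sum_a D1 i a * D2 j q a)
  - (\sum_a D2 q i a * D1 j a + \sum_a D1 i a * D2 q j a)))).
rewrite -[RHS]/(\sum_a invmx (g x) l q * D1 q a * D2 i j a).
have {S}S a i' j' : D2 i' j' a = D2 j' i' a by exact: S.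
clearbody D1 D2; apply: merge_six_sums => a.
by rewrite (S a i q) (S a j q) (S a j i); field.
Qed.

Let h i j x := \sum_a V a x * pderiv i (pderiv j (F a)) x.

Let h_sym x i j : O x -> h i j x = h j i x.
Proof.
move=> Ox; rewrite /h; apply: eq_bigr => a _.
by rewrite (schwarz i j oO Ox (Ck_pred (Cf a))).
Qed.

Let hE x i j : O x -> h i j x = - \sum_a pderiv i (V a) x * pderiv j (F a) x.
Proof.
move=> Ox; rewrite (pderiv_dot_cst oO i Ox Cnu (C1f1 j) (fun y Oy => nt Oy j)).
by rewrite opprK.
Qed.

(** Both sides are minus the product of V with a mixed second derivative of F.  This is where the
    integrability of the tangent spaces of the leaves enters. *)
Lemma second_form_symmetric x i j : O x ->
  \sum_a pderiv i (V a) x * pderiv j (F a) x = \sum_a pderiv j (V a) x * pderiv i (F a) x.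
Proof. by move=> Ox; rewrite -[LHS]opprK -[RHS]opprK -(hE i j Ox) -(hE j i Ox) (h_sym i j Ox). Qed.

Let resolution x a b : O x ->
  \sum_p dual p a x * pderiv p (F b) x + V a x * V b x + F a x * F b x = (a == b)%:R.
Proof.
move=> Ox.
have dotE (u v : 'rV[R]_n.+2) (c : R) : \sum_a u 0 a * v 0 a = c -> u *m v^T = c%:M.
  move=> <-; apply/matrixP => i j; rewrite !ord1 !mxE eqxx mulr1n.
  by apply: eq_bigr => l _; rewrite mxE.
have JN (u : 'rV[R]_n.+2) : (forall i, \sum_a u 0 a * pderiv i (F a) x = 0) -> tangent_mx x *m u^T = 0.
  move=> H; apply/matrixP => i j; rewrite !ord1 [LHS]mxE [RHS]mxE -[RHS](H i).
  by apply: eq_bigr => l _; rewrite !mxE mulrC.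
pose nu := \row_a V a x; pose f := \row_a F a x.
have rowE (u : 'I_n.+2 -> R) : (\row_a u a) 0 =1 u by move=> c; rewrite mxE.
have dE (u v : 'I_n.+2 -> R) (c : R) : \sum_a u a * v a = c -> (\row_a u a) *m (\row_a v a)^T = c%:M.
  by move=> uvc; apply: dotE; under eq_bigr do rewrite !rowE.
have NN : nu *m nu^T = 1%:M by exact: (dE (fun a => V a x) (fun a => V a x) 1 (nn Ox)).
have PP : f *m f^T = 1%:M by exact: (dE (fun a => F a x) (fun a => F a x) 1 (ff Ox)).
have NP : nu *m f^T = 0 by rewrite (dE (fun a => V a x) (fun a => F a x) 0 (nf Ox)) raddf0.
have JNu : tangent_mx x *m nu^T = 0.
  by apply: JN => i; under eq_bigr do rewrite rowE; exact: nt.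
have JF : tangent_mx x *m f^T = 0.
  apply: JN => i; under eq_bigr do rewrite rowE.
  by rewrite -[RHS](tangent_pos i Ox); apply: eq_bigr => l _; rewrite mulrC.
have JJu : tangent_mx x *m (tangent_mx x)^T \in unitmx by rewrite -metricE// gu.
have := frame_resolution JJu JNu JF NN PP NP.
move=> /matrixP/(_ a b); rewrite -metricE// !mxE !big_ord1 !mxE => E.
transitivity ((a == b)%:R - V a x * V b x - F a x * F b x + V a x * V b x + F a x * F b x); last by ring.
rewrite -E; congr (_ + _ + _); apply: eq_bigr => p _; rewrite !mxE; congr (_ * _).
by apply: eq_bigr => q _; rewrite !mxE ginv_sym// mulrC.
Qed.

Let second_pos x j k : O x -> \sum_a pderiv j (pderiv k (F a)) x * F a x = - g x j k.
Proof.
move=> Ox; rewrite (pderiv_dot_cst oO j Ox (C1f1 k) C1f (fun y Oy => tangent_pos k Oy)).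
by rewrite g_sym// gE.
Qed.

(** The Gauss formula: the components along the dual vectors, the normal and the position vector. *)
Let second_expand x j k a : O x ->
  pderiv j (pderiv k (F a)) x =
  \sum_p Gam p j k x * pderiv p (F a) x + h j k x * V a x - g x j k * F a x.
Proof.
move=> Ox; pose H b := pderiv j (pderiv k (F b)) x.
have GamH p : Gam p j k x = \sum_b dual p b x * H b by [].
have hH : h j k x = \sum_b V b x * H b by [].
have gH : \sum_b H b * F b x = - g x j k by exact: second_pos.
rewrite -[LHS]/(H a); clearbody H.
transitivity (\sum_b H b * (b == a)%:R).
  by rewrite (bigD1 a)//= eqxx mulr1 big1 ?addr0// => b /negPf->; rewrite mulr0.
under eq_bigr do rewrite -(resolution _ _ Ox) !mulrDr.
rewrite !big_split /=; congr (_ + _ + _).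
- under eq_bigr do rewrite mulr_sumr.
  rewrite exchange_big /=; apply: eq_bigr => p _; rewrite GamH mulr_suml; apply: eq_bigr => b _.
  by rewrite mulrA [H b * _]mulrC.
- by rewrite hH mulr_suml; apply: eq_bigr => b _; ring.
- by rewrite -mulNr -gH mulr_suml; apply: eq_bigr => b _; rewrite mulrA.
Qed.

Let W l i x := - \sum_a dual l a x * pderiv i (V a) x.

(** Since the products of the dual vectors with the frame are constant, differentiating them moves
    the derivative to the frame; the frame expansion of the second derivatives does the rest. *)
Let dual_second x l i j k : O x ->
  \sum_a pderiv i (dual l a) x * pderiv j (pderiv k (F a)) x =
  - (\sum_p Gam l i p x * Gam p j k x) + W l i x * h j k x + (l == i)%:R * g x j k.
Proof.
move=> Ox; under eq_bigr do rewrite (second_expand _ _ _ Ox) mulrBr mulrDr.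
rewrite sumrB big_split /=; congr (_ + _ + _).
- under eq_bigr do rewrite mulr_sumr.
  rewrite exchange_big /= -sumrN; apply: eq_bigr => p _.
  have := pderiv_dot_cst oO i Ox (Cdual l) (C1f1 p) (fun y Oy => dual_tangent l p Oy).
  rewrite -/(Gam l i p x) -mulNr => <-; rewrite mulr_suml.
  by apply: eq_bigr => a _; ring.
- rewrite /W -(pderiv_dot_cst oO i Ox (Cdual l) Cnu (fun y Oy => dual_nu l Oy)).
  by rewrite mulr_suml; apply: eq_bigr => a _; ring.
- rewrite -(dual_tangent _ _ Ox).
  rewrite -[X in X * g x j k]opprK -(pderiv_dot_cst oO i Ox (Cdual l) C1f (fun y Oy => dual_pos l Oy)).
  by rewrite mulNr; congr (- _); rewrite mulr_suml; apply: eq_bigr => a _; ring.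
Qed.

Let riemannE x l k i j : O x -> riemann g l k i j x =
  W l i x * h j k x - W l j x * h i k x + (l == i)%:R * g x j k - (l == j)%:R * g x i k.
Proof.
move=> Ox; rewrite /riemann.
pose T i' j' := \sum_a dual l a x * pderiv i' (pderiv j' (pderiv k (F a))) x.
(* the third derivatives cancel in the curvature *)
have third : T j i = T i j.
  by apply: eq_bigr => a _; rewrite (schwarz i j oO Ox (Cf1 k a)).
have dG i' j' : pderiv i' (christoffel g l j' k) x =
    - (\sum_p Gam l i' p x * Gam p j' k x) + W l i' x * h j' k x + (l == i')%:R * g x j' k + T i' j'.
  rewrite -(dual_second l i' j' k Ox) /T.
  rewrite -(@pderiv_dot _ _ O _ (dual l) (fun a => pderiv j' (pderiv k (F a))) i' x Ox (Cdual l) (Cf2 j' k)).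
  by apply: (eq_pderiv _ oO Ox) => y Oy; exact: christoffelE.
clearbody T.
have E3 : \sum_(p < n) (christoffel g l i p x * christoffel g p j k x
                  - christoffel g l j p x * christoffel g p i k x) =
   \sum_(p < n) Gam l i p x * Gam p j k x - \sum_(p < n) Gam l j p x * Gam p i k x.
  rewrite -sumrB; apply: eq_bigr => p _.
  by rewrite -(christoffelE l i p Ox) -(christoffelE p j k Ox)
    -(christoffelE l j p Ox) -(christoffelE p i k Ox).
have cancel (a b w1 w2 d1 d2 t : R) :
    (- a + w1 + d1 + t) - (- b + w2 + d2 + t) + (a - b) = w1 - w2 + d1 - d2 by ring.
by rewrite (dG i j) (dG j i) third E3 cancel.
Qed.

(** Here S is, up to sign, the shape operator; the square of its trace minus the trace of its square
    is 2 S_2, and the term n (n - 1) is the contribution of the ambient unit sphere. *)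
Theorem gauss_equation x : O x ->
  let S := invmx (g x) *m (tangent_mx x *m (normal_mx x)^T) in
  \sum_j \sum_k invmx (g x) j k * ricci g j k x =
    n%:R * (n%:R - 1) + (\tr S) ^+ 2 - \tr (S *m S).
Proof.
move=> Ox S.
pose hm := \matrix_(i, j) h i j x.
have hms : hm^T = hm by apply/matrixP => i j; rewrite !mxE h_sym.
have gs : (g x)^T = g x by apply/matrixP => i j; rewrite mxE g_sym.
have hmE : tangent_mx x *m (normal_mx x)^T = - hm.
  apply/matrixP => i j; rewrite !mxE (h_sym i j Ox) (hE j i Ox) opprK.
  by apply: eq_bigr => a _; rewrite !mxE mulrC.
have WE l i : W l i x = (invmx (g x) *m hm) l i.
  rewrite -[hm]opprK -hmE mulmxN [RHS]mxE; congr (- _); rewrite mxE.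
  under eq_bigr do rewrite mulr_suml.
  rewrite exchange_big /=; apply: eq_bigr => q _; rewrite mxE mulr_sumr.
  by apply: eq_bigr => a _; rewrite !mxE mulrA.
have -> : (\tr S) ^+ 2 = (\tr (invmx (g x) *m hm)) ^+ 2.
  by rewrite /S hmE mulmxN linearN sqrrN.
have -> : \tr (S *m S) = \tr (invmx (g x) *m hm *m (invmx (g x) *m hm)).
  by rewrite /S hmE !mulmxN mulNmx opprK.
rewrite -(scalar_contraction (mulVmx (gu Ox)) hms gs).
apply: eq_bigr => j _; apply: eq_bigr => k _; congr (_ * _).
rewrite /ricci; apply: eq_bigr => i _; rewrite (riemannE i k i j Ox) (WE i i) (WE i j).
by rewrite [hm j k]mxE [hm i k]mxE.
Qed.

End Gauss.

(** * Divergence of the weighted Newton field *)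

Section CkRules.
Context {R : realType} {m : nat}.
Implicit Types (f g : 'rV[R]_m -> R) (O : set 'rV[R]_m).

Lemma pderiv_add O f g i x : O x -> Ck 1 O f -> Ck 1 O g ->
  pderiv i (fun y => f y + g y) x = pderiv i f x + pderiv i g x.
Proof.
move=> Ox Cf Cg; apply: pderivD; [exact: Ck_derivable Cf Ox|exact: Ck_derivable Cg Ox].
Qed.

Lemma pderiv_mul O f g i x : O x -> Ck 1 O f -> Ck 1 O g ->
  pderiv i (fun y => f y * g y) x = pderiv i f x * g x + f x * pderiv i g x.
Proof.
move=> Ox Cf Cg; apply: pderivM; [exact: Ck_derivable Cf Ox|exact: Ck_derivable Cg Ox].
Qed.

Lemma pderiv_sub O f g i x : O x -> Ck 1 O f -> Ck 1 O g ->
  pderiv i (fun y => f y - g y) x = pderiv i f x - pderiv i g x.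
Proof.
move=> Ox Cf Cg.
exact: (deriveB (@Ck_derivable _ _ _ _ _ _ i Cf Ox) (@Ck_derivable _ _ _ _ _ _ i Cg Ox)).
Qed.

Lemma pderiv_sum O q (F : 'I_q -> 'rV[R]_m -> R) i x : O x -> (forall a, Ck 1 O (F a)) ->
  pderiv i (fun y => \sum_a F a y) x = \sum_a pderiv i (F a) x.
Proof.
move=> Ox CF; rewrite /pderiv (_ : (fun y => _) = \sum_a (F a)); last first.
  by apply/funext => y; rewrite fct_sumE.
by rewrite derive_sum// => a; exact: Ck_derivable (CF a) Ox.
Qed.

Lemma Ck_expR O f : open O -> Ck 1 O f -> Ck 1 O (fun x => expR (f x)).
Proof.
move=> oO; apply: (@C1_comp_scalar _ _ _ oO expR expR); last exact: continuous_expR.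
Qed.

Lemma pderiv_exp O f i x : open O -> O x -> Ck 1 O f ->
  pderiv i (fun y => expR (f y)) x = expR (f x) * pderiv i f x.
Proof.
move=> oO Ox Cf.
by have [_] := chain_rule_scalar oO i Cf Ox (is_derive_expR (f x)).
Qed.

Definition normsq (x : 'rV[R]_m) : R := \sum_a x 0 a * x 0 a.

Lemma Ck_normsq k O : open O -> Ck k O normsq.
Proof. by move=> oO; apply: Ck_sum => // a _; apply: CkM => //; exact: Ck_coord. Qed.

Lemma sum_delta (u : 'I_m -> R) i : \sum_a u a * (a == i)%:R = u i.
Proof. by rewrite (bigD1 i)//= eqxx mulr1 big1 ?addr0// => a /negPf->; rewrite mulr0. Qed.

Lemma pderiv_normsq i x : pderiv i normsq x = 2 * x 0 i.
Proof.
have Cc (a : 'I_m) : Ck 1 setT (fun y : 'rV[R]_m => y 0 a) by exact: Ck_coord.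
rewrite /normsq (@pderiv_dot _ _ setT _ (fun a y => y 0 a) (fun a y => y 0 a) i x I Cc Cc).
have -> : \sum_a pderiv i (fun y : 'rV[R]_m => y 0 a) x * x 0 a = x 0 i.
  by rewrite -[RHS](sum_delta (fun a => x 0 a)); apply: eq_bigr => a _; rewrite pderiv_coord mulrC.
have -> : \sum_a x 0 a * pderiv i (fun y : 'rV[R]_m => y 0 a) x = x 0 i.
  by rewrite -[RHS](sum_delta (fun a => x 0 a)); apply: eq_bigr => a _; rewrite pderiv_coord.
by rewrite mulr_natl mulr2n.
Qed.

End CkRules.

Section DivAlgebra.
Context {K : comPzRingType} {I : finType}.
Variables (N : I -> K) (D : I -> I -> K) (H : I -> I -> I -> K).
Hypothesis Hsym : forall a b c, H a b c = H b a c.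

(** With D a b = d_a N_b and H a b c = d_a d_b N_c, the left-hand side is the divergence of the
    derivative of N along D_N N. *)
Lemma divergence_algebra :
  \sum_a \sum_c ((\sum_b D a b * D b c + \sum_b N b * H a b c) * D c a
                 + (\sum_b N b * D b c) * H a c a)
  = \sum_a \sum_b \sum_c D a b * D b c * D c a
    + \sum_b N b * (\sum_a \sum_c D c a * H b a c)
    + \sum_c (\sum_b N b * D b c) * \sum_a H c a a.
Proof.
under eq_bigr do under eq_bigr do rewrite mulrDl.
under eq_bigr do rewrite !big_split /=.
rewrite !big_split /=; congr (_ + _ + _).
- apply: eq_bigr => a _; rewrite exchange_big /=; apply: eq_bigr => b _.
  by rewrite mulr_suml.
- under [RHS]eq_bigr do rewrite mulr_sumr.
  rewrite [RHS]exchange_big /=; apply: eq_bigr => a _.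
  under [RHS]eq_bigr do rewrite mulr_sumr.
  rewrite [RHS]exchange_big /=; apply: eq_bigr => c _.
  by rewrite mulr_suml; apply: eq_bigr => b _; rewrite Hsym mulrA mulrAC -mulrA.
- rewrite exchange_big /=; apply: eq_bigr => c _; rewrite mulr_sumr.
  by apply: eq_bigr => a _; rewrite Hsym.
Qed.
End DivAlgebra.

Section Field.
Context {R : realType} {m : nat}.
Variable N : 'I_m -> 'rV[R]_m -> R.
Let Om : set 'rV[R]_m := [set x | 0 < normsq x].
Hypothesis CN : forall a, Ck 2 Om (N a).
Hypothesis NN : forall x, Om x -> \sum_a N a x * N a x = 1.
Hypothesis Nx : forall x, Om x -> \sum_a N a x * x 0 a = 0.
Hypothesis xD : forall x a, Om x -> \sum_b x 0 b * pderiv b (N a) x = 0.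

Lemma open_punctured : open [set x : 'rV[R]_m | 0 < normsq x].
Proof.
have cq : continuous (@normsq R m).
  by move=> x; exact: (Ck_continuous (Ck_normsq 0 openT) (I : setT x)).
by move: cq => /continuousP/(_ [set t : R | 0 < t]); apply; exact: open_gt.
Qed.
Let oOm : open Om := open_punctured.

Definition dN b a : 'rV[R]_m -> R := pderiv b (N a).
Definition accN c (x : 'rV[R]_m) : R := \sum_b N b x * dN b c x.
Definition divN (x : 'rV[R]_m) : R := \sum_a dN a a x.
(** These are tr D^2, sigma_2(D) and, below, tr D^3, where D is the Jacobian of N. *)
Definition trN2 (x : 'rV[R]_m) : R := \sum_a \sum_c dN a c x * dN c a x.
Definition sigma2 (x : 'rV[R]_m) : R := 2^-1 * (divN x * divN x - trN2 x).
(** The factor |x|^2 makes sigma_2 homogeneous of degree 0. *)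
Definition nsigma2 (x : 'rV[R]_m) : R := normsq x * sigma2 x.
(** On the unit sphere this is T_1 applied to the leafwise acceleration of N, with T_1 = S_1 - A.  The
    last term removes the radial component. *)
Definition newtonN a (x : 'rV[R]_m) : R :=
  \sum_c accN c x * dN c a x - divN x * accN a x - divN x * (x 0 a * (normsq x)^-1).
(** With a weight exp (lambda S_2), the divergence has a sign as soon as lambda (n - 1) > 1; for
    n >= 2 the value lambda = 2 suffices. *)
Definition wfield a (x : 'rV[R]_m) : R := expR (2 * nsigma2 x) * (2 * newtonN a x + N a x * (normsq x)^-1).

Let C1N a : Ck 1 Om (N a) := Ck_pred (CN a).
Lemma C1_dN b a : Ck 1 Om (dN b a). Proof. exact: (Ck_pderiv b (CN a)). Qed.
Let C1q : Ck 1 Om (@normsq R m). Proof. exact: (Ck_normsq 1 oOm). Qed.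
Let C1qV : Ck 1 Om (fun x => (normsq x)^-1).
Proof.
have q0 x : Om x -> normsq x != 0 by move=> Ox; rewrite gt_eqF.
exact: (CkV oOm q0 C1q).
Qed.
Lemma C1_accN c : Ck 1 Om (accN c).
Proof. exact: (Ck_sum oOm _ (fun b _ => CkM oOm (C1N b) (C1_dN b c))). Qed.
Lemma C1_divN : Ck 1 Om divN.
Proof. exact: (Ck_sum oOm _ (fun b _ => C1_dN b b)). Qed.
Let Ct2in a : Ck 1 Om (fun x => \sum_c dN a c x * dN c a x).
Proof. exact: (Ck_sum oOm _ (fun c _ => CkM oOm (C1_dN a c) (C1_dN c a))). Qed.
Lemma C1_trN2 : Ck 1 Om trN2.
Proof. exact: (Ck_sum oOm _ (fun a _ => Ct2in a)). Qed.
Let Cs1s1 : Ck 1 Om (fun x => divN x * divN x) := CkM oOm C1_divN C1_divN.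
Let Cs1t2 : Ck 1 Om (fun x => divN x * divN x - trN2 x) := CkB oOm Cs1s1 C1_trN2.
Lemma C1_sigma2 : Ck 1 Om sigma2. Proof. exact: (CkM oOm (Ck_cst 1 Om 2^-1) Cs1t2). Qed.
Lemma C1_nsigma2 : Ck 1 Om nsigma2. Proof. exact: (CkM oOm C1q C1_sigma2). Qed.
Let Cxq a : Ck 1 Om (fun x => x 0 a * (normsq x)^-1) := CkM oOm (Ck_coord 1 Om a) C1qV.
Let CUD a : Ck 1 Om (fun x => \sum_c accN c x * dN c a x).
Proof. exact: (Ck_sum oOm _ (fun c _ => CkM oOm (C1_accN c) (C1_dN c a))). Qed.
Let Cs1U a : Ck 1 Om (fun x => divN x * accN a x) := CkM oOm C1_divN (C1_accN a).
Let Cs1xq a : Ck 1 Om (fun x => divN x * (x 0 a * (normsq x)^-1)) := CkM oOm C1_divN (Cxq a).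
Let CUDU a : Ck 1 Om (fun x => \sum_c accN c x * dN c a x - divN x * accN a x) := CkB oOm (CUD a) (Cs1U a).
Lemma C1_newtonN a : Ck 1 Om (newtonN a). Proof. exact: (CkB oOm (CUDU a) (Cs1xq a)). Qed.
Let CNq a : Ck 1 Om (fun x => N a x * (normsq x)^-1) := CkM oOm (C1N a) C1qV.
Let C2sf : Ck 1 Om (fun x => 2 * nsigma2 x) := CkM oOm (Ck_cst 1 Om 2) C1_nsigma2.
Let CE : Ck 1 Om (fun x => expR (2 * nsigma2 x)) := Ck_expR oOm C2sf.
Let C2Y a : Ck 1 Om (fun x => 2 * newtonN a x) := CkM oOm (Ck_cst 1 Om 2) (C1_newtonN a).
Let CYN a : Ck 1 Om (fun x => 2 * newtonN a x + N a x * (normsq x)^-1) := CkD oOm (C2Y a) (CNq a).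
Lemma C1_wfield a : Ck 1 Om (wfield a). Proof. exact: (CkM oOm CE (CYN a)). Qed.

Lemma dN_normal x b : Om x -> \sum_a dN b a x * N a x = 0.
Proof.
move=> Ox; have E := pderiv_dot_cst oOm b Ox C1N C1N NN.
have E2 : \sum_a N a x * pderiv b (N a) x = \sum_a dN b a x * N a x.
  by apply: eq_bigr => a _; rewrite mulrC.
have {E2}E : \sum_a dN b a x * N a x = - \sum_a dN b a x * N a x by rewrite -[in RHS]E2.
by move: E; set S := \sum_a _ => E; lra.
Qed.

Lemma dN_position x b : Om x -> \sum_a dN b a x * x 0 a = - N b x.
Proof.
move=> Ox.
rewrite (pderiv_dot_cst oOm b Ox C1N (fun a => @Ck_coord _ _ 1 Om a) Nx).
by congr (- _); rewrite -[RHS](sum_delta (fun a => N a x)); apply: eq_bigr => a _; rewrite pderiv_coord.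
Qed.

Lemma dN_schwarz x a b c : Om x -> pderiv a (dN b c) x = pderiv b (dN a c) x.
Proof. by move=> Ox; exact: (schwarz a b oOm Ox (CN c)). Qed.

(** Euler's relation for dN, which is homogeneous of degree -1. *)
Lemma dN_euler x c a : Om x -> \sum_b x 0 b * pderiv b (dN c a) x = - dN c a x.
Proof.
move=> Ox.
have := pderiv_dot_cst oOm c Ox (fun b => @Ck_coord _ _ 1 Om b) (fun b => C1_dN b a) (fun y Oy => xD a Oy).
have -> : \sum_b pderiv c (fun x : 'rV[R]_m => x 0 b) x * dN b a x = dN c a x.
  by rewrite -[RHS](sum_delta (fun b => dN b a x)); apply: eq_bigr => b _; rewrite pderiv_coord mulrC.
move=> ->; rewrite opprK; apply: eq_bigr => b _; by rewrite (dN_schwarz b c a Ox).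
Qed.

Lemma pderiv_divN x b : Om x -> pderiv b divN x = \sum_a pderiv b (dN a a) x.
Proof. by move=> Ox; exact: (pderiv_sum b Ox (fun a => C1_dN a a)). Qed.

Lemma pderiv_trN2 x b : Om x -> pderiv b trN2 x = 2 * \sum_a \sum_c dN c a x * pderiv b (dN a c) x.
Proof.
move=> Ox.
rewrite /trN2 (@pderiv_sum _ _ Om _ (fun a y => \sum_c dN a c y * dN c a y) b x Ox Ct2in).
have E a : pderiv b (fun y => \sum_c dN a c y * dN c a y) x =
    \sum_c dN c a x * pderiv b (dN a c) x + \sum_c dN a c x * pderiv b (dN c a) x.
  rewrite (@pderiv_dot _ _ Om _ (dN a) (fun c => dN c a) b x Ox (C1_dN a) (fun c => C1_dN c a)).
  by congr (_ + _); apply: eq_bigr => c _; rewrite mulrC.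
under eq_bigr do rewrite E; rewrite big_split /=.
by rewrite [X in _ + X]exchange_big /= mulr_natl mulr2n.
Qed.

(** Half of the derivative of tr D^2. *)
Definition dtrN2 b x := \sum_a \sum_c dN c a x * pderiv b (dN a c) x.
Definition trN3 x := \sum_a \sum_b \sum_c dN a b x * dN b c x * dN c a x.

Lemma radial_divN x : Om x -> \sum_b x 0 b * pderiv b divN x = - divN x.
Proof.
move=> Ox; under eq_bigr do rewrite (pderiv_divN _ Ox) mulr_sumr.
by rewrite exchange_big /= /divN -sumrN; apply: eq_bigr => a _; rewrite (dN_euler a a Ox).
Qed.

Lemma radial_dtrN2 x : Om x -> \sum_b x 0 b * dtrN2 b x = - trN2 x.
Proof.
move=> Ox; rewrite /dtrN2 /trN2 -sumrN; under eq_bigr do rewrite mulr_sumr.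
rewrite exchange_big /=; apply: eq_bigr => a _; rewrite -sumrN.
under eq_bigr do rewrite mulr_sumr.
rewrite exchange_big /=; apply: eq_bigr => c _.
rewrite -[RHS]mulNr -(dN_euler a c Ox) mulr_suml; apply: eq_bigr => b _.
by rewrite mulrCA mulrC.
Qed.

Lemma pderiv_nsigma2 x b : Om x ->
  pderiv b nsigma2 x = 2 * x 0 b * sigma2 x + normsq x * (divN x * pderiv b divN x - dtrN2 b x).
Proof.
move=> Ox; rewrite /nsigma2 (pderiv_mul b Ox C1q C1_sigma2) pderiv_normsq; congr (_ + _ * _).
rewrite /sigma2 (pderiv_mul b Ox (Ck_cst 1 Om 2^-1) Cs1t2) pderiv_cst mul0r add0r.
rewrite (pderiv_sub b Ox Cs1s1 C1_trN2) (pderiv_mul b Ox C1_divN C1_divN) (pderiv_trN2 b Ox) -/(dtrN2 b x).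
have half (u g t : R) : 2^-1 * (g * u + u * g - 2 * t) = u * g - t by field.
exact: half.
Qed.

Lemma radial_nsigma2 x : Om x -> \sum_b x 0 b * pderiv b nsigma2 x = 0.
Proof.
move=> Ox.
have E b : x 0 b * pderiv b nsigma2 x = 2 * sigma2 x * (x 0 b * x 0 b)
    + (normsq x * divN x * (x 0 b * pderiv b divN x) - normsq x * (x 0 b * dtrN2 b x)).
  have rearr (xb s2 q s1 g t : R) : xb * (2 * xb * s2 + q * (s1 * g - t)) =
    2 * s2 * (xb * xb) + (q * s1 * (xb * g) - q * (xb * t)) by ring.
  by rewrite (pderiv_nsigma2 b Ox) rearr.
rewrite (eq_bigr _ (fun b _ => E b)) big_split /= sumrB -!mulr_sumr (radial_divN Ox) (radial_dtrN2 Ox).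
rewrite -/(normsq x) /sigma2.
have fin (q s1 t2 : R) : 2 * (2^-1 * (s1 * s1 - t2)) * q + (q * s1 * - s1 - q * - t2) = 0 by field.
exact: fin.
Qed.

Lemma pderiv_accN x a c : Om x ->
  pderiv a (accN c) x = \sum_b dN a b x * dN b c x + \sum_b N b x * pderiv a (dN b c) x.
Proof. by move=> Ox; exact: (@pderiv_dot _ _ Om _ N (fun b => dN b c) a x Ox C1N (fun b => C1_dN b c)). Qed.

Lemma div_accN x : Om x -> \sum_a pderiv a (accN a) x = trN2 x + \sum_b N b x * pderiv b divN x.
Proof.
move=> Ox; under eq_bigr do rewrite (pderiv_accN _ _ Ox).
rewrite big_split /=; congr (_ + _).
rewrite exchange_big /=; apply: eq_bigr => b _; rewrite (pderiv_divN b Ox) mulr_sumr.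
by apply: eq_bigr => a _; rewrite (dN_schwarz a b a Ox).
Qed.

Lemma pderiv_position_over_normsq x a : Om x ->
  pderiv a (fun x => x 0 a * (normsq x)^-1) x =
  (normsq x)^-1 - 2 * (normsq x)^-1 * (normsq x)^-1 * (x 0 a * x 0 a).
Proof.
move=> Ox; rewrite (pderiv_mul a Ox (Ck_coord 1 Om a) C1qV) pderiv_coord eqxx mul1r.
congr (_ + _); rewrite pderivV; last exact: Ck_derivable C1q Ox; last by rewrite gt_eqF.
have rearr (u v : R) : u * (- v * v * (2 * u)) = - (2 * v * v * (u * u)) by ring.
by rewrite pderiv_normsq rearr.
Qed.

Lemma div_newtonN x : Om x -> \sum_a pderiv a (newtonN a) x =
  trN3 x + \sum_b N b x * dtrN2 b x - divN x * trN2 x - divN x * (\sum_b N b x * pderiv b divN x)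
  - (m%:R - 3) * divN x * (normsq x)^-1.
Proof.
move=> Ox.
have E a : pderiv a (newtonN a) x =
   \sum_c ((\sum_b dN a b x * dN b c x + \sum_b N b x * pderiv a (dN b c) x) * dN c a x
      + (\sum_b N b x * dN b c x) * pderiv a (dN c a) x)
   - (accN a x * pderiv a divN x + divN x * pderiv a (accN a) x)
   - ((normsq x)^-1 * (x 0 a * pderiv a divN x)
      + divN x * ((normsq x)^-1 - 2 * (normsq x)^-1 * (normsq x)^-1 * (x 0 a * x 0 a))).
  rewrite /newtonN (pderiv_sub a Ox (CUDU a) (Cs1xq a)) (pderiv_sub a Ox (CUD a) (Cs1U a)).
  congr (_ - _ - _).
  - rewrite (@pderiv_dot _ _ Om _ accN (fun c => dN c a) a x Ox C1_accN (fun c => C1_dN c a)) -big_split /=.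
    by apply: eq_bigr => c _; rewrite (pderiv_accN a c Ox).
  - by rewrite (pderiv_mul a Ox C1_divN (C1_accN a)) [_ * accN a x]mulrC.
  - rewrite (pderiv_mul a Ox C1_divN (Cxq a)) (pderiv_position_over_normsq a Ox); congr (_ + _).
    by move: (pderiv a divN x) (x 0 a) (normsq x)^-1 => u v w; ring.
have first_term := @divergence_algebra _ _ (fun b => N b x) (fun a b => dN a b x)
  (fun a b c => pderiv a (dN b c) x) (fun a b c => dN_schwarz a b c Ox).
have EC : \sum_c (\sum_b N b x * dN b c x) * (\sum_a pderiv c (dN a a) x)
    = \sum_a accN a x * pderiv a divN x.
  by apply: eq_bigr => c _; rewrite (pderiv_divN c Ox).
rewrite (eq_bigr _ (fun a _ => E a)) !sumrB first_term EC -/(trN3 x).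
rewrite -[\sum_b N b x * \sum_a _]/(\sum_b N b x * dtrN2 b x).
rewrite !big_split /= -!mulr_sumr (div_accN Ox) (radial_divN Ox).
rewrite sumrB -mulr_sumr -/(normsq x) sumr_const card_ord.
set A := trN3 x; set B := \sum_b N b x * dtrN2 b x; set C := \sum_c _; set t := trN2 x.
set G := \sum_b N b x * _; set s := divN x; rewrite -[(normsq x)^-1 *+ m]mulr_natl.
have q0 : normsq x != 0 by rewrite gt_eqF.
have : (normsq x)^-1 * normsq x = 1 by rewrite mulVf.
set v := (normsq x)^-1; set q := normsq x => vq.
clearbody A B C t G s v q.
have -> : v * - s + s * (m%:R * v - 2 * v * v * q) = (m%:R - 1) * s * v - 2 * s * v * (v * q) by ring.
by rewrite vq; ring.
Qed.

Lemma newtonN_orth_normal x : Om x -> \sum_a newtonN a x * N a x = 0.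
Proof.
move=> Ox; rewrite /newtonN.
under eq_bigr do rewrite !mulrBl -!mulrA.
rewrite !sumrB -!mulr_sumr.
have -> : \sum_a (\sum_c accN c x * dN c a x) * N a x = 0.
  under eq_bigr do rewrite mulr_suml.
  rewrite exchange_big /= big1// => c _.
  under eq_bigr do rewrite -mulrA.
  by rewrite -mulr_sumr (dN_normal c Ox) mulr0.
have -> : \sum_a accN a x * N a x = 0.
  under eq_bigr do rewrite mulr_suml.
  rewrite exchange_big /= big1// => c _.
  under eq_bigr do rewrite -mulrA.
  by rewrite -mulr_sumr (dN_normal c Ox) mulr0.
have -> : \sum_a x 0 a * ((normsq x)^-1 * N a x) = (normsq x)^-1 * \sum_a N a x * x 0 a.
  by rewrite mulr_sumr; apply: eq_bigr => a _; rewrite mulrCA [x 0 a * _]mulrC.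
by rewrite (Nx Ox) !mulr0 !subr0.
Qed.

Lemma accN_position x : Om x -> \sum_a accN a x * x 0 a = -1.
Proof.
move=> Ox; under eq_bigr do rewrite mulr_suml.
rewrite exchange_big /= -(NN Ox) -sumrN; apply: eq_bigr => c _.
under eq_bigr do rewrite -mulrA.
by rewrite -mulr_sumr (dN_position c Ox) mulrN.
Qed.

Lemma newtonN_orth_position x : Om x -> \sum_a newtonN a x * x 0 a = 0.
Proof.
move=> Ox; rewrite /newtonN.
under eq_bigr do rewrite !mulrBl -!mulrA.
rewrite !sumrB -!mulr_sumr (accN_position Ox).
have -> : \sum_a (\sum_c accN c x * dN c a x) * x 0 a = 0.
  under eq_bigr do rewrite mulr_suml.
  rewrite exchange_big /=.
  transitivity (- \sum_c accN c x * N c x).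
    rewrite -sumrN; apply: eq_bigr => c _.
    under eq_bigr do rewrite -mulrA.
    by rewrite -mulr_sumr (dN_position c Ox) mulrN.
  under eq_bigr do rewrite mulr_suml.
  rewrite exchange_big /= big1 ?oppr0// => c _.
  under eq_bigr do rewrite -mulrA.
  by rewrite -mulr_sumr (dN_normal c Ox) mulr0.
have -> : \sum_a x 0 a * ((normsq x)^-1 * x 0 a) = 1.
  rewrite -[RHS](@mulVf _ (normsq x)) ?gt_eqF// [in RHS]/normsq mulr_sumr.
  by apply: eq_bigr => a _; rewrite mulrCA.
by rewrite mulr1 mulrN1 sub0r opprK subrr.
Qed.

Lemma wfield_orth_position x : Om x -> \sum_a wfield a x * x 0 a = 0.
Proof.
move=> Ox; rewrite /wfield.
have E a : expR (2 * nsigma2 x) * (2 * newtonN a x + N a x * (normsq x)^-1) * x 0 a =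
   expR (2 * nsigma2 x) * 2 * (newtonN a x * x 0 a) + expR (2 * nsigma2 x) * (normsq x)^-1 * (N a x * x 0 a).
  by move: (expR _) (newtonN a x) (N a x) (normsq x)^-1 (x 0 a) => *; ring.
rewrite (eq_bigr _ (fun a _ => E a)) big_split /= -!mulr_sumr (newtonN_orth_position Ox) (Nx Ox).
by rewrite !mulr0 addr0.
Qed.

(** The factor lam is the derivative of [nsigma2] along N; through the weight, it cancels the term
    N (sigma_2) of div Y. *)
Theorem div_wfield x (lam : R) : Om x -> (forall a, pderiv a nsigma2 x = lam * N a x) ->
  \sum_a pderiv a (wfield a) x =
  expR (2 * nsigma2 x) * (2 * trN3 x - 2 * divN x * trN2 x - (2 * m%:R - 7) * divN x * (normsq x)^-1).
Proof.
move=> Ox grad.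
have lamE : lam = normsq x * (divN x * (\sum_b N b x * pderiv b divN x) - \sum_b N b x * dtrN2 b x).
  rewrite -[LHS]mulr1 -(NN Ox) mulr_sumr.
  transitivity (\sum_a (2 * sigma2 x * (N a x * x 0 a) +
     (normsq x * divN x * (N a x * pderiv a divN x) - normsq x * (N a x * dtrN2 a x)))).
    apply: eq_bigr => a _; rewrite mulrA -grad (pderiv_nsigma2 a Ox).
    by move: (x 0 a) (sigma2 x) (normsq x) (divN x) (pderiv a divN x) (dtrN2 a x) (N a x) => *; ring.
  by rewrite big_split /= sumrB -!mulr_sumr (Nx Ox) mulr0 add0r mulrBr mulrA.
have E a : pderiv a (wfield a) x = expR (2 * nsigma2 x) *
   (2 * lam * (2 * (newtonN a x * N a x) + (normsq x)^-1 * (N a x * N a x))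
    + (2 * pderiv a (newtonN a) x
       + ((normsq x)^-1 * dN a a x - 2 * (normsq x)^-1 * (normsq x)^-1 * (N a x * x 0 a)))).
  rewrite /wfield (pderiv_mul a Ox CE (CYN a)) (pderiv_exp a oOm Ox C2sf).
  rewrite (pderiv_mul a Ox (Ck_cst 1 Om 2) C1_nsigma2) pderiv_cst mul0r add0r grad.
  rewrite (pderiv_add a Ox (C2Y a) (CNq a)) (pderiv_mul a Ox (Ck_cst 1 Om 2) (C1_newtonN a)).
  rewrite pderiv_cst mul0r add0r.
  rewrite (pderiv_mul a Ox (C1N a) C1qV) -/(dN a a x).
  rewrite pderivV; last exact: Ck_derivable C1q Ox; last by rewrite gt_eqF.
  rewrite pderiv_normsq.
  by move: (expR _) (newtonN a x) (N a x) (normsq x)^-1 (x 0 a) (dN a a x) (pderiv a (newtonN a) x) => *; ring.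
rewrite (eq_bigr _ (fun a _ => E a)) -mulr_sumr; congr (_ * _).
rewrite !big_split /= -!mulr_sumr big_split /= -!mulr_sumr (newtonN_orth_normal Ox) (NN Ox) (div_newtonN Ox).
rewrite sumrN -!mulr_sumr (Nx Ox) -/(divN x) lamE.
have q0 : normsq x != 0 by rewrite gt_eqF.
move: (trN3 x) (divN x) (trN2 x) (\sum_b N b x * dtrN2 b x) (\sum_b _) (normsq x) q0.
by move=> A s t B G q q0; field.
Qed.

End Field.

(** * Traces of the shape operator and the sign of the divergence *)

Section Frame.
Context {R : realType} {n : nat}.
Variable N : 'I_n.+2 -> 'rV[R]_n.+2 -> R.
Let Om : set 'rV[R]_n.+2 := [set x | 0 < normsq x].
Hypothesis CN : forall a, Ck 2 Om (N a).
Hypothesis NN : forall x, Om x -> \sum_a N a x * N a x = 1.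
Hypothesis Nx : forall x, Om x -> \sum_a N a x * x 0 a = 0.
Hypothesis xD : forall x a, Om x -> \sum_b x 0 b * pderiv b (N a) x = 0.

Definition normal_row x : 'rV[R]_n.+2 := \row_a N a x.
Definition dN_mx x : 'M[R]_n.+2 := \matrix_(b, a) dN N b a x.

Let colE (u : 'rV[R]_n.+2) i : u^T i 0 = u 0 i. Proof. by rewrite mxE. Qed.

Let DNT x : Om x -> dN_mx x *m (normal_row x)^T = 0.
Proof.
move=> Ox; apply/matrixP => b i; rewrite !ord1 [LHS]mxE [RHS]mxE -[RHS](dN_normal CN NN b Ox).
by apply: eq_bigr => a _; rewrite !mxE.
Qed.
Let xDm x : Om x -> x *m dN_mx x = 0.
Proof.
move=> Ox; apply/matrixP => i a; rewrite !ord1 [LHS]mxE [RHS]mxE -[RHS](xD a Ox).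
by apply: eq_bigr => b _; rewrite mxE.
Qed.
Let DxT x : Om x -> dN_mx x *m x^T = - (normal_row x)^T.
Proof.
move=> Ox; apply/matrixP => b i; rewrite !ord1 [LHS]mxE [RHS]mxE.
rewrite [(normal_row x)^T b 0]mxE [normal_row x 0 b]mxE -[RHS](dN_position CN Nx b Ox).
by apply: eq_bigr => a _; rewrite colE mxE.
Qed.
Let NNT x : Om x -> normal_row x *m (normal_row x)^T = 1%:M.
Proof.
move=> Ox; apply/matrixP => i j; rewrite !ord1 [LHS]mxE [RHS]mxE eqxx mulr1n -[RHS](NN Ox).
by apply: eq_bigr => a _; rewrite !mxE.
Qed.
Let NxT x : Om x -> normal_row x *m x^T = 0.
Proof.
move=> Ox; apply/matrixP => i j; rewrite !ord1 [LHS]mxE [RHS]mxE -[RHS](Nx Ox).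
by apply: eq_bigr => a _; rewrite !mxE.
Qed.

Lemma mulmx_normsq (x : 'rV[R]_n.+2) : x *m x^T = (normsq x)%:M.
Proof.
apply/matrixP => i j; rewrite !ord1 [LHS]mxE [RHS]mxE eqxx mulr1n.
by apply: eq_bigr => a _; rewrite mxE.
Qed.

Lemma mxtrace_dN x : \tr (dN_mx x) = divN N x.
Proof. by apply: eq_bigr => a _; rewrite mxE. Qed.
Lemma mxtrace_dN2 x : \tr (dN_mx x *m dN_mx x) = trN2 N x.
Proof.
rewrite mxtrace_mulmxE; apply: eq_bigr => a _; apply: eq_bigr => c _.
by rewrite [dN_mx x a c]mxE [dN_mx x c a]mxE.
Qed.
Lemma mxtrace_dN3 x : \tr (dN_mx x *m dN_mx x *m dN_mx x) = trN3 N x.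
Proof.
rewrite mxtrace_mulmxE; apply: eq_bigr => a _; rewrite exchange_big /=; apply: eq_bigr => c _.
rewrite [(dN_mx x *m dN_mx x) a c]mxE mulr_suml; apply: eq_bigr => b _.
by rewrite [dN_mx x a b]mxE [dN_mx x b c]mxE [dN_mx x c a]mxE.
Qed.

Section AtPoint.
Variables (x : 'rV[R]_n.+2) (J : 'M[R]_(n, n.+2)).
Hypothesis Ox : Om x.
Hypothesis Ju : J *m J^T \in unitmx.
Hypothesis JN : J *m (normal_row x)^T = 0.
Hypothesis Jx : J *m x^T = 0.
Let P := J^T *m invmx (J *m J^T) *m J.

Lemma leaf_projection : P = 1%:M - (normal_row x)^T *m normal_row x - (normsq x)^-1 *: (x^T *m x).
Proof.
have q0 : normsq x != 0 by rewrite gt_eqF.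
pose rho := Num.sqrt (normsq x); have r0 : rho != 0 by rewrite gt_eqF// sqrtr_gt0.
have r2 : rho ^+ 2 = normsq x by rewrite sqr_sqrtr// ltW.
pose p := rho^-1 *: x.
have pT : p^T = rho^-1 *: x^T by rewrite linearZ.
have Jp : J *m p^T = 0 by rewrite pT -scalemxAr Jx scaler0.
have pp : p *m p^T = 1%:M.
  by rewrite pT -scalemxAr -scalemxAl scalerA mulmx_normsq scale_scalar_mx -r2 -invfM -expr2 mulVf// expf_neq0.
have Np : normal_row x *m p^T = 0 by rewrite pT -scalemxAr (NxT Ox) scaler0.
rewrite /P (frame_resolution Ju JN Jp (NNT Ox) pp Np).
by rewrite pT -scalemxAl -scalemxAr scalerA -invfM -expr2 r2.
Qed.

Lemma leaf_traces :
  [/\ P *m dN_mx x *m P = P *m dN_mx x, P *m dN_mx x *m P *m dN_mx x = P *m dN_mx x *m dN_mx x,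
      \tr (P *m dN_mx x) = divN N x, \tr (P *m dN_mx x *m dN_mx x) = trN2 N x
    & \tr (P *m dN_mx x *m dN_mx x *m dN_mx x) = trN3 N x].
Proof.
rewrite -mxtrace_dN -mxtrace_dN2 -mxtrace_dN3.
have q0 : normsq x != 0 by rewrite gt_eqF.
exact: (homogeneous_traces q0 (DNT Ox) (xDm Ox) (DxT Ox) (NNT Ox) (NxT Ox) leaf_projection).
Qed.

Hypothesis Jsym : (J *m dN_mx x *m J^T)^T = J *m dN_mx x *m J^T.

(** The compression of D by P is symmetric because J D J^T is, and it has the same traces as D. *)
Lemma trace_cube_bound : 0 <= trN2 N x /\ trN3 N x ^+ 2 <= trN2 N x ^+ 3.
Proof.
have [PDP PDPD _ t2 t3] := leaf_traces.
have gs : (J *m J^T)^T = J *m J^T by rewrite trmx_mul trmxK.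
have Cs : (P *m dN_mx x)^T = P *m dN_mx x.
  have E : P *m dN_mx x *m P = J^T *m invmx (J *m J^T) *m (J *m dN_mx x *m J^T) *m invmx (J *m J^T) *m J.
    by rewrite /P !mulmxA.
  rewrite -PDP E; move: Jsym gs; set K := J *m dN_mx x *m J^T; set g := J *m J^T => Ks gs'.
  move: (K) (g) Ks gs' => {}K {}g Ks gs'.
  by rewrite !trmx_mul trmxK trmx_inv gs' Ks !mulmxA.
have E2 : P *m dN_mx x *m (P *m dN_mx x) = P *m dN_mx x *m dN_mx x by rewrite mulmxA.
have E3 : P *m dN_mx x *m (P *m dN_mx x) *m (P *m dN_mx x) = P *m dN_mx x *m dN_mx x *m dN_mx x.
  by rewrite -mulmxA E2 [LHS]mulmxA E2.
by have := symmetric_trace_cube Cs; rewrite E3 E2 t2 t3.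
Qed.

Hypothesis sf0 : 0 < nsigma2 N x.

(** Positivity of sigma_2 means tr D^2 < (tr D)^2, so |tr D tr D^3| is at most (tr D)^2 tr D^2; what
    remains in the bracket is - (2 n - 3) (tr D) / |x|^2. *)
Lemma divergence_sign : (2 <= n)%N -> let E := 2 * trN3 N x - 2 * divN N x * trN2 N x
    - (2 * n.+2%:R - 7) * divN N x * (normsq x)^-1 in
  divN N x != 0 /\ 0 < Num.sg (- divN N x) * E.
Proof.
move=> n2 E; have [t20 t3t2] := trace_cube_bound.
have v0 : 0 < (normsq x)^-1 by rewrite invr_gt0.
have st2 : trN2 N x < divN N x ^+ 2.
  move: sf0; rewrite /nsigma2 pmulr_rgt0// /sigma2 pmulr_rgt0 ?invr_gt0// subr_gt0.
  by rewrite expr2.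
have n2R : 2 <= n%:R :> R by rewrite ler_nat.
have mE : n.+2%:R = n%:R + 2 :> R by rewrite -addn2 natrD.
rewrite {}/E mE.
move: (trN3 N x) (trN2 N x) (divN N x) (normsq x)^-1 (n%:R) t20 t3t2 v0 st2 n2R.
move=> t3 t2 s v k t20 t3t2 v0 st2 k2.
set E := (X in _ * X).
have s20 : 0 < s ^+ 2 by exact: le_lt_trans t20 st2.
have s0 : s != 0 by apply: contraTneq s20 => ->; rewrite expr0n ltxx.
split=> //.
have st3 : `|s * t3| <= s ^+ 2 * t2.
  have H : 0 <= s ^+ 2 * t2 by exact: mulr_ge0 (sqr_ge0 _) t20.
  rewrite -(@ler_pXn2r _ 2) ?nnegrE ?normr_ge0// real_normK ?num_real//.
  have -> : (s ^+ 2 * t2) ^+ 2 = s ^+ 2 * (s ^+ 2 * t2 ^+ 2) by ring.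
  rewrite exprMn ler_wpM2l ?(ltW s20)//; apply: le_trans t3t2 _.
  by rewrite exprS ler_wpM2r ?sqr_ge0// ltW.
have sE : s * E < 0.
  have H1 : s * t3 <= s ^+ 2 * t2 by exact: le_trans (ler_norm _) st3.
  have H2 : 0 < (2 * k - 3) * v * s ^+ 2 by apply: mulr_gt0 s20; apply: mulr_gt0 v0; lra.
  rewrite (_ : s * E = 2 * (s * t3) - 2 * (s ^+ 2 * t2) - (2 * k - 3) * v * s ^+ 2); first lra.
  by rewrite /E; ring.
rewrite sgrN mulNr oppr_gt0.
have : 0 < s \/ s < 0 by move: s0; rewrite neq_lt orbC => /orP.
case=> sg; [rewrite gtr0_sg// mul1r|rewrite ltr0_sg// mulN1r oppr_lt0].
  by move: sE; rewrite pmulr_rlt0.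
by move: sE; rewrite nmulr_rlt0.
Qed.

End AtPoint.
End Frame.

(** * Radial extension and slices of charts *)

Section Charts.
Context {R : realType}.

Lemma open_preimage p (T : topologicalType) (U : set 'rV[R]_p) (O : set T) (rho : 'rV[R]_p -> T) :
  open U -> open O -> (forall x, U x -> {for x, continuous rho}) ->
  open (U `&` rho @^-1` O).
Proof.
move=> oU oO cr; rewrite openE => x [accN_position Ox].
have n1 : \forall y \near x, U y by exact: near_open.
have n2 : \forall y \near x, O (rho y) by exact: (cr x accN_position) (open_nbhs_nbhs (conj oO Ox)).
by apply: filterS2 n1 n2.
Qed.

Lemma Ck_continuous_rV k p m (U : set 'rV[R]_p) (rho : 'rV[R]_p -> 'rV[R]_m) x :
  (forall a, Ck k U (fun y => rho y 0 a)) -> U x -> {for x, continuous rho}.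
Proof. by move=> Cr accN_position; apply: continuous_rV => a; exact: Ck_continuous (Cr a) accN_position. Qed.

Lemma smooth_on_open_Ck k p m (U : set 'rV[R]_p) (f : 'rV[R]_p -> 'rV[R]_m) a :
  open U -> smooth_on U f -> Ck k U (fun x => f x 0 a).
Proof.
move=> oU sf; apply: Ck_local => x accN_position; have [W [F [oW Wx sF Ff]]] := sf x accN_position.
have oUO : open (U `&` W) by exact: openI.
exists (U `&` W) => //; apply: (@Ck_ext _ _ k _ (fun x => F x 0 a)) => //.
  by move=> y [Uy Oy]; rewrite Ff.
by apply: (@Ck_sub _ _ k W) => [y []//|]; exact: smooth_open_Ck.
Qed.

Section RadialExtension.
Context {m : nat}.
Implicit Type x : 'rV[R]_m.+1.

Definition ray x := (Num.sqrt (normsq x))^-1 *: x.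

Lemma normsqZ (t : R) x : normsq (t *: x) = t ^+ 2 * normsq x.
Proof. by rewrite /normsq mulr_sumr; apply: eq_bigr => a _; rewrite !mxE; ring. Qed.

Lemma ray_sphere x : 0 < normsq x -> unit_sphere R m (ray x).
Proof.
move=> x0; rewrite /unit_sphere /= -[LHS]/(normsq (ray x)) normsqZ.
by rewrite exprVn sqr_sqrtr ?ltW// mulVf ?gt_eqF.
Qed.

Lemma rayZ (t : R) x : 0 < t -> ray (t *: x) = ray x.
Proof.
move=> t0; rewrite /ray normsqZ sqrtrM ?sqr_ge0// sqrtr_sqr gtr0_norm//.
by rewrite scalerA invfM mulrAC mulVf ?gt_eqF// mul1r.
Qed.

Lemma ray_id x : unit_sphere R m x -> ray x = x.
Proof.
rewrite /unit_sphere /= => x1; rewrite /ray.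
have -> : normsq x = 1 by exact: x1.
by rewrite sqrtr1 invr1 scale1r.
Qed.

Lemma Ck_ray k a : Ck k [set x : 'rV[R]_m.+1 | 0 < normsq x] (fun x => ray x 0 a).
Proof.
have oO := @open_punctured R m.+1.
have Cs : Ck k [set x : 'rV[R]_m.+1 | 0 < normsq x] (fun x => Num.sqrt (normsq x)).
  by apply: Ck_sqrt => //; exact: Ck_normsq.
have s0 x : 0 < normsq x -> Num.sqrt (normsq x) != 0 by move=> ?; rewrite gt_eqF// sqrtr_gt0.
apply: (@Ck_ext _ _ k _ (fun x => (Num.sqrt (normsq x))^-1 * x 0 a)) => //.
  by move=> x _; rewrite mxE.
exact: (CkM oO (CkV oO s0 Cs) (Ck_coord k _ a)).
Qed.

Lemma Ck_radial k (N : 'rV[R]_m.+1 -> 'rV[R]_m.+1) a :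
  smooth_on (unit_sphere R m) N ->
  Ck k [set x : 'rV[R]_m.+1 | 0 < normsq x] (fun x => N (ray x) 0 a).
Proof.
move=> sN; apply: Ck_local => x Ox.
have [W [F [oW Fx sF FN]]] := sN _ (ray_sphere Ox).
pose U := [set x : 'rV[R]_m.+1 | 0 < normsq x] `&` ray @^-1` W.
have Cr a' : Ck k U (fun x => ray x 0 a') by apply: (Ck_sub _ (Ck_ray k a')) => y [].
have oU : open U.
  have cr (y : 'rV[R]_m.+1) : 0 < normsq y -> {for y, continuous ray}.
    move=> Oy; exact: (@Ck_continuous_rV 0 _ _ _ ray y (Ck_ray 0) Oy).
  exact: (open_preimage (@open_punctured R m.+1) oW cr).
exists U => //.
apply: (@Ck_ext _ _ k U (fun x => F (ray x) 0 a)) => //.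
  by move=> y [Oy Fy]; rewrite FN//; exact: ray_sphere.
apply: (Ck_comp (h := fun y => F y 0 a) oU oW) => //; first by move=> y [].
exact: smooth_open_Ck.
Qed.

Lemma radial_derivative (f : 'rV[R]_m.+1 -> R) x :
  0 < normsq x -> Ck 1 [set x : 'rV[R]_m.+1 | 0 < normsq x] f ->
  (forall t, 0 < t -> f (t *: x) = f x) -> \sum_b x 0 b * pderiv b f x = 0.
Proof.
move=> x0 Cf fh; have df := Ck_differentiable (@open_punctured R m.+1) Cf x0.
rewrite -derive_sum_pderiv// -[x in 'D_x f _]/(x).
have d1 : derivable f (x + (0:R) *: x) x by rewrite scale0r addr0; exact: diff_derivable.
have [_] := is_derive_line d1; rewrite scale0r addr0 => <-.
transitivity ('D_1 (fun _ : R => f x) (0:R)); last exact: derive_cst.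
apply: near_eq_derive; near=> t.
rewrite -{1}[x]scale1r -scalerDl fh//.
have : `|t| < 1 by near: t; exact: (@nbhs0_lt _ R).
by rewrite ltr_norml => /andP[]; lra.
Unshelve. all: by end_near. Qed.

End RadialExtension.

Section Slice.
Context {n : nat}.

Lemma open_cube : open (@cube R n).
Proof.
rewrite openE => z cz.
have near_j (j : 'I_(n + 1)) : \forall w \near (z : 'rV[R]_(n + 1)), `|(w : 'rV[R]_(n + 1)) 0 j| < 1.
  have cc : {for z, continuous (fun w : 'rV[R]_(n + 1) => w 0 j : R)} by exact: coord_continuous.
  have e0 : 0 < 1 - `|z 0 j| by rewrite subr_gt0.
  have /continuous_normP/(_ _ e0) := cc; apply: filterS => w.
  rewrite distrC => zw; rewrite -(subrK (z 0 j) (w 0 j)).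
  by apply: le_lt_trans (ler_normD _ _) _; rewrite -ltrBrDr.
have : \forall w \near (z : 'rV[R]_(n + 1)), forall j, `|(w : 'rV[R]_(n + 1)) 0 j| < 1.
  exact: filter_forall near_j.
exact.
Qed.

Definition slice_dom (y : 'rV[R]_1) : set 'rV[R]_n := [set x | @cube R n (row_mx x y)].


Lemma Ck_row_mx k (U : set 'rV[R]_n) (y : 'rV[R]_1) (j : 'I_(n + 1)) : open U ->
  Ck k U (fun x => row_mx x y 0 j : R).
Proof.
move=> oU; case: (split_ordP j) => [i|i] ->.
  by apply: Ck_ext (Ck_coord k U i) => // x _; rewrite row_mxEl.
by apply: Ck_ext (Ck_cst k U (y 0 i)) => // x _; rewrite row_mxEr.
Qed.

Lemma open_slice_dom y : open (slice_dom y).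
Proof.
have cr (x : 'rV[R]_n) : setT x -> {for x, continuous (fun x => row_mx x y)}.
  by move=> Tx; apply: (@Ck_continuous_rV 0 _ _ setT _ x _ Tx) => a; exact: (Ck_row_mx 0 y a openT).
by have := open_preimage openT open_cube cr; rewrite setTI.
Qed.

Lemma Ck_slice k (G : 'rV[R]_(n + 1) -> R) (y : 'rV[R]_1) : Ck k (@cube R n) G ->
  Ck k (slice_dom y) (fun x => G (row_mx x y)).
Proof.
move=> CG.
have H := (@Ck_comp _ _ _ k (fun x => row_mx x y) G _ _ (@open_slice_dom y) open_cube
  (fun x (h : slice_dom y x) => h)
  (fun a => Ck_row_mx k y a (@open_slice_dom y)) CG).
exact: H.
Qed.

Lemma pderiv_slice (G : 'rV[R]_(n + 1) -> R) (y : 'rV[R]_1) i (x : 'rV[R]_n) :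
  pderiv i (fun x => G (row_mx x y)) x = pderiv (lshift 1 i) G (row_mx x y).
Proof.
have E : (fun h : R => h^-1 *: (((fun x => G (row_mx x y)) \o shift x) (h *: delta_mx 0 i) - G (row_mx x y))) =
    (fun h : R => h^-1 *: ((G \o shift (row_mx x y)) (h *: delta_mx 0 (lshift 1 i)) - G (row_mx x y))).
  apply/funext => h /=; congr (_ *: (G _ - _)).
  have -> : delta_mx 0 (lshift 1 i) = row_mx (delta_mx 0 i) 0 :> 'rV[R]_(n + 1).
    apply/rowP => j; case: (split_ordP j) => l ->; rewrite ?row_mxEl ?row_mxEr !mxE eqxx /=.
      by rewrite eq_lshift.
    by rewrite eq_rlshift.
  by rewrite scale_row_mx add_row_mx scaler0 add0r.
by rewrite /pderiv /derive E.
Qed.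

End Slice.
End Charts.

(** * The extended normal of a foliation of the sphere *)

Lemma gram_unit (R : realFieldType) n m (J : 'M[R]_(n, m)) (H : 'M[R]_(m, n)) :
  J *m H = 1%:M -> J *m J^T \in unitmx.
Proof.
move=> JH; rewrite -row_free_unit; apply/inj_row_free => v vJJ.
suff vJ : v *m J = 0 by rewrite -[v]mulmx1 -JH mulmxA vJ mul0mx.
have : v *m J *m (v *m J)^T = 0 by rewrite trmx_mul -!mulmxA [J *m _]mulmxA [v *m _]mulmxA vJJ mul0mx.
move=> /matrixP/(_ 0 0); rewrite [LHS]mxE [RHS]mxE => vv0.
apply/rowP => a; rewrite [RHS]mxE.
apply: (@sum_sqr_eq0 _ _ (fun a => (v *m J) 0 a)); rewrite -[RHS]vv0.
by apply: eq_bigr => b _; rewrite [(v *m J)^T b 0]mxE expr2.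
Qed.

Lemma shape_trace (R : comPzRingType) n m (T : 'M[R]_(n, m)) (G : 'M[R]_n) (D : 'M[R]_m) :
  \tr (G *m (T *m D *m T^T)) = \tr (T^T *m G *m T *m D).
Proof. by rewrite !mulmxA mxtrace_mulC !mulmxA. Qed.

Lemma shape_trace2 (R : comPzRingType) n m (T : 'M[R]_(n, m)) (G : 'M[R]_n) (D : 'M[R]_m) :
  \tr (G *m (T *m D *m T^T) *m (G *m (T *m D *m T^T))) =
  \tr (T^T *m G *m T *m D *m (T^T *m G *m T) *m D).
Proof.
have -> : G *m (T *m D *m T^T) *m (G *m (T *m D *m T^T)) =
    G *m (T *m (D *m (T^T *m G *m T) *m D) *m T^T) by rewrite !mulmxA.
by rewrite shape_trace !mulmxA.
Qed.

Section ChartGeometry.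
Context {R : realType} {n m : nat}.
Variables (M : set 'rV[R]_m) (c : chart R n m).
Hypothesis sc : smooth_chart M c.

Lemma Ck_param k a : Ck k (@cube R n) (fun z => param c z 0 a).
Proof. by have [_ _ sp _] := sc; exact: smooth_on_open_Ck (@open_cube R n) sp. Qed.

Lemma param_in z : cube z -> M (param c z).
Proof.
move=> cz; have [[W _ dom] _ _ _] := sc.
have : chart_dom c (param c z) by exists z.
by rewrite dom => -[].
Qed.

(** A local extension of the coordinate map to the ambient space provides the right inverse. *)
Lemma param_immersion z : cube z ->
  exists H : 'M[R]_(m, n + 1),
    (\matrix_(i, a) pderiv i (fun w => param c w 0 a : R) z) *m H = 1%:M.
Proof.
move=> cz; have [_ inv _ scoord] := sc.
have [W [G [oW Wp sG GE]]] := scoord (param c z) (ex_intro2 _ _ z cz erefl).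
exists (\matrix_(a, j) pderiv a (fun q => G q 0 j : R) (param c z)).
have cp w : cube w -> {for w, continuous (param c)}.
  by move=> cw; exact: (@Ck_continuous_rV _ 0 _ _ _ (param c) w (Ck_param 0) cw).
have oU := open_preimage (@open_cube R n) oW cp.
apply/matrixP => i j; rewrite mxE [RHS]mxE.
have CpU a : Ck 1 (@cube R n `&` param c @^-1` W) (fun w => param c w 0 a).
  by apply: (Ck_sub _ (Ck_param 1 a)) => w [].
have CG : Ck 1 W (fun q => G q 0 j) by exact: smooth_open_Ck oW sG.
have [_ chain] := chain_rule (rho := param c) (h := fun q => G q 0 j) i oU oW (conj cz Wp) Wp CpU CG.
transitivity (pderiv i (fun w => G (param c w) 0 j) z).
  by rewrite chain; apply: eq_bigr => a _; rewrite !mxE mulrC.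
rewrite (_ : pderiv i _ z = pderiv i (fun w : 'rV[R]_(n + 1) => w 0 j : R) z).
  by rewrite pderiv_coord eq_sym.
apply: (eq_pderiv i oU (conj cz Wp)) => w [cw Ww].
by rewrite GE ?inv//; exists w.
Qed.

End ChartGeometry.

Section Foliated.
Context {R : realType} {n : nat}.
Variables (A : set (chart R n n.+2)) (N : 'rV[R]_n.+2 -> 'rV[R]_n.+2).
Local Notation S := (unit_sphere R n.+1).
Hypothesis n2 : (2 <= n)%N.
Hypothesis fol : foliation S A.
Hypothesis sN : smooth_on S N.
Hypothesis N1 : forall p, S p -> dotp (N p) (N p) = 1.
Hypothesis Ntan : forall c z, A c -> cube z -> exists v, N (param c z) = 'D_v (param c) z.
Hypothesis Northo : forall c x y, A c -> cube (row_mx x y) -> forall i : 'I_n,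
  dotp (N (plaque_map c y x)) (pderiv i (plaque_map c y) x) = 0.
Hypothesis leaf_scal : forall L : set 'rV[R]_n.+2, is_leaf S A L ->
  exists2 r : R, 1 < r & leaf_scalar_curvature A L r.

Definition Nrad a (x : 'rV[R]_n.+2) : R := N (ray x) 0 a.
Let Om : set 'rV[R]_n.+2 := [set x | 0 < normsq x].

Lemma Ck_Nrad k a : Ck k Om (Nrad a). Proof. exact: Ck_radial. Qed.

Lemma Nrad_unit x : Om x -> \sum_a Nrad a x * Nrad a x = 1.
Proof. by move=> Ox; exact: (N1 (ray_sphere Ox)). Qed.

Lemma Nrad_radial x a : Om x -> \sum_b x 0 b * pderiv b (Nrad a) x = 0.
Proof.
move=> Ox; apply: (radial_derivative Ox (Ck_Nrad 1 a)) => t t0.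
by rewrite /Nrad rayZ.
Qed.

Let chartA c : A c -> smooth_chart S c.
Proof. by have [H _ _] := fol; exact: H. Qed.

Lemma param_derivative_orth c z i : A c -> cube z ->
  \sum_a pderiv i (fun w => param c w 0 a) z * param c z 0 a = 0.
Proof.
move=> Ac cz; have Cp a := Ck_param (chartA Ac) 1 a.
have sph w : cube w -> \sum_a param c w 0 a * param c w 0 a = 1.
  by move=> cw; exact: (param_in (chartA Ac) cw).
have E := pderiv_dot_cst (@open_cube R n) i cz Cp Cp sph.
move: E; rewrite [X in - X](eq_bigr (fun a => pderiv i (fun w => param c w 0 a) z * param c z 0 a)).
  by set T := \sum_a _ => E; lra.
by move=> a _; rewrite mulrC.
Qed.

Lemma param_differentiable c z : A c -> cube z -> differentiable (param c) z.
Proof.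
move=> Ac cz; apply: differentiable_rV => a.
exact: (Ck_differentiable (@open_cube R n) (Ck_param (chartA Ac) 1 a) cz).
Qed.

Lemma normal_orth_position c z : A c -> cube z ->
  \sum_a N (param c z) 0 a * param c z 0 a = 0.
Proof.
move=> Ac cz; have [v ->] := Ntan Ac cz.
have dp := param_differentiable Ac cz.
have E a : ('D_v (param c) z) 0 a = \sum_i v 0 i * pderiv i (fun w => param c w 0 a) z.
  rewrite derive_mx; last exact: diff_derivable.
  rewrite mxE; apply: derive_sum_pderiv.
  exact: (Ck_differentiable (@open_cube R n) (Ck_param (chartA Ac) 1 a) cz).
under eq_bigr do rewrite E mulr_suml.
rewrite exchange_big /= big1// => i _.
under eq_bigr do rewrite -mulrA.
by rewrite -mulr_sumr (param_derivative_orth i Ac cz) mulr0.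
Qed.

Lemma chart_at p : S p -> exists c x y, [/\ A c, cube (row_mx x y) & plaque_map c y x = p].
Proof.
move=> Sp; have [_ cov _] := fol; have [c Ac [z cz zp]] := cov p Sp.
by exists c, (lsubmx z), (rsubmx z); rewrite /plaque_map hsubmxK.
Qed.

Lemma Nrad_orth x : Om x -> \sum_a Nrad a x * x 0 a = 0.
Proof.
move=> Ox; have [c [x0 [y [Ac cz E]]]] := chart_at (ray_sphere Ox).
have r0 : Num.sqrt (normsq x) != 0 by rewrite gt_eqF// sqrtr_gt0.
have xE : x = Num.sqrt (normsq x) *: ray x by rewrite scalerA mulfV// scale1r.
have := normal_orth_position Ac cz; rewrite -/(plaque_map c y x0) E => H.
transitivity (Num.sqrt (normsq x) * \sum_a N (ray x) 0 a * ray x 0 a); last by rewrite H mulr0.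
rewrite mulr_sumr; apply: eq_bigr => a _; rewrite /Nrad {2}xE mxE.
by rewrite mulrCA.
Qed.

Section Plaque.
Variables (c : chart R n n.+2) (y : 'rV[R]_1) (rho : R).
Hypothesis Ac : A c.
Hypothesis rho0 : 0 < rho.
Let f x := plaque_map c y x.
Let F a := fun x : 'rV[R]_n => f x 0 a : R.
Let V a := fun x : 'rV[R]_n => Nrad a (rho *: f x).
Let O := @slice_dom R n y.
Let oO : open O := @open_slice_dom R n y.

Let CF k a : Ck k O (F a).
Proof. exact: (Ck_slice y (Ck_param (chartA Ac) k a)). Qed.

Let Sf x : O x -> S (f x).
Proof. by move=> Ox; exact: (param_in (chartA Ac) Ox). Qed.

Let nf1 x : O x -> normsq (rho *: f x) = rho ^+ 2.
Proof. by move=> Ox; rewrite normsqZ [normsq _](Sf Ox) mulr1. Qed.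

Let Of x : O x -> Om (rho *: f x).
Proof. by move=> Ox; rewrite /Om /= nf1// exprn_gt0. Qed.

Let VE a x : O x -> V a x = N (f x) 0 a.
Proof. by move=> Ox; rewrite /V /Nrad rayZ// ray_id//; exact: Sf. Qed.

Let Crf k a : Ck k O (fun x => (rho *: f x) 0 a).
Proof.
apply: (@Ck_ext _ _ k O (fun x => rho * F a x)) => //; first by move=> x _; rewrite mxE.
exact: (CkM oO (Ck_cst k O rho) (CF k a)).
Qed.

Let CV a : Ck 1 O (V a).
Proof.
exact: (@Ck_comp _ _ _ 1 (fun x => rho *: f x) (Nrad a) O Om oO
  (@open_punctured R n.+2) Of (Crf 1) (Ck_Nrad 1 a)).
Qed.

Let pd_scaled x i a : O x -> pderiv i (fun x => (rho *: f x) 0 a) x = rho * pderiv i (F a) x.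
Proof.
move=> Ox; rewrite (_ : pderiv i _ x = pderiv i (fun x => rho * F a x) x).
  by rewrite (pderiv_mul i Ox (Ck_cst 1 O rho) (CF 1 a)) pderiv_cst mul0r add0r.
by apply: (eq_pderiv i oO Ox) => w _; rewrite mxE.
Qed.

Lemma pderiv_along_plaque (h : 'rV[R]_n.+2 -> R) x i : O x -> Ck 1 Om h ->
  pderiv i (fun x => h (rho *: f x)) x =
  rho * \sum_b pderiv i (F b) x * pderiv b h (rho *: f x).
Proof.
move=> Ox Ch.
have [_ ->] := chain_rule (rho := fun x => rho *: f x) (h := h) i oO
  (@open_punctured R n.+2) Ox (Of Ox) (Crf 1) Ch.
rewrite mulr_sumr; apply: eq_bigr => b _; rewrite (pd_scaled i b Ox).
by rewrite mulrCA [pderiv b h _ * _]mulrC.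
Qed.

Let normal_mxE x : O x ->
  normal_mx V x = rho *: (tangent_mx F x *m dN_mx Nrad (rho *: f x)).
Proof.
move=> Ox; apply/matrixP => i a; rewrite [LHS]mxE [RHS]mxE [(tangent_mx F x *m _) i a]mxE.
rewrite (pderiv_along_plaque i Ox (Ck_Nrad 1 a)); congr (_ * _); apply: eq_bigr => b _.
by rewrite [tangent_mx F x i b]mxE [dN_mx _ _ b a]mxE.
Qed.

Let derf x i : O x -> derivable f x (delta_mx 0 i).
Proof.
move=> Ox; apply/derivable_mxP => j a; rewrite ord1.
exact: (@Ck_derivable _ _ _ _ _ _ i (CF 1 a) Ox).
Qed.

Let pdf x i a : O x -> (pderiv i f x) 0 a = pderiv i (F a) x.
Proof. by move=> Ox; have [_ ->] := pderiv_component a (@derf x i Ox). Qed.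

Let metricE x : O x -> forall i j,
  plaque_metric c y x i j = \sum_a pderiv i (F a) x * pderiv j (F a) x.
Proof.
move=> Ox i j; rewrite mxE; apply: eq_bigr => a _.
by rewrite -(pdf i a Ox) -(pdf j a Ox).
Qed.

Let metric_mx x : O x -> plaque_metric c y x = tangent_mx F x *m (tangent_mx F x)^T.
Proof.
move=> Ox; apply/matrixP => i j; rewrite (metricE Ox) mxE; apply: eq_bigr => a _.
by rewrite !mxE.
Qed.

Lemma plaque_gram_unit x : O x -> tangent_mx F x *m (tangent_mx F x)^T \in unitmx.
Proof.
move=> Ox; have [H KH] := param_immersion (chartA Ac) Ox.
apply: (@gram_unit _ _ _ _ (lsubmx H)); apply/matrixP => i j.
have := congr1 (fun B : 'M[R]_(n + 1) => B (lshift 1 i) (lshift 1 j)) KH.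
rewrite !mxE eq_lshift => <-; apply: eq_bigr => a _; rewrite !mxE; congr (_ * _).
exact: (pderiv_slice (fun z => param c z 0 a)).
Qed.

Let VF x : O x -> forall i, \sum_a V a x * pderiv i (F a) x = 0.
Proof.
move=> Ox i; rewrite -[RHS](Northo Ac Ox i); apply: eq_bigr => a _.
by rewrite (VE a Ox) -(pdf i a Ox).
Qed.

Lemma plaque_normal_orth x : O x -> tangent_mx F x *m (normal_row Nrad (rho *: f x))^T = 0.
Proof.
move=> Ox; apply/matrixP => i j; rewrite [LHS]mxE [RHS]mxE -[RHS](VF Ox i).
by apply: eq_bigr => a _; rewrite !mxE mulrC.
Qed.

Lemma plaque_position_orth x : O x -> tangent_mx F x *m (rho *: f x)^T = 0.
Proof.
move=> Ox; apply/matrixP => i j; rewrite [LHS]mxE [RHS]mxE.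
transitivity (rho * \sum_a pderiv (lshift 1 i) (fun w => param c w 0 a) (row_mx x y)
    * param c (row_mx x y) 0 a).
  rewrite mulr_sumr; apply: eq_bigr => a _; rewrite !mxE !ord1.
  rewrite -(pderiv_slice (fun z => param c z 0 a)).
  by rewrite mulrCA.
by rewrite (param_derivative_orth _ Ac Ox) mulr0.
Qed.

Lemma plaque_shape_symmetric x : O x ->
  let K := tangent_mx F x *m dN_mx Nrad (rho *: f x) *m (tangent_mx F x)^T in K^T = K.
Proof.
move=> Ox K.
have Ks : (rho *: K)^T = rho *: K.
  rewrite /K scalemxAl -(normal_mxE Ox); apply/matrixP => i j; rewrite mxE ![(_ *m _) _ _]mxE.
  have := second_form_symmetric oO (CF 3) CV VF j i Ox => E.
  transitivity (\sum_a pderiv j (V a) x * pderiv i (F a) x).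
    by apply: eq_bigr => a _; rewrite !mxE.
  by rewrite E; apply: eq_bigr => a _; rewrite !mxE.
apply: (scalerI (lt0r_neq0 rho0)); rewrite -[in RHS]Ks linearZ //.
Qed.

(** The plaque is scaled by rho, so that it meets an arbitrary point of the punctured space and not
    only the points of the sphere; the derivatives of N are scaled accordingly. *)
Lemma plaque_scalar_curvature x : O x ->
  scalar_curvature (plaque_metric c y) x * (n%:R * (n%:R - 1)) =
  n%:R * (n%:R - 1) + 2 * nsigma2 Nrad (rho *: f x).
Proof.
move=> Ox; rewrite /scalar_curvature divfK; last first.
  have : 2 <= n%:R :> R by rewrite ler_nat.
  by move=> ?; rewrite mulf_neq0//; lra.
have VV w : O w -> \sum_a V a w * V a w = 1 by move=> Ow; exact: (Nrad_unit (Of Ow)).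
have FF w : O w -> \sum_a F a w * F a w = 1 by move=> Ow; exact: (Sf Ow).
have VFo w : O w -> \sum_a V a w * F a w = 0.
  move=> Ow; rewrite -[RHS](normal_orth_position Ac Ow); apply: eq_bigr => a _.
  by rewrite (VE a Ow).
have gu w : O w -> plaque_metric c y w \in unitmx.
  by move=> Ow; rewrite (metric_mx Ow); exact: plaque_gram_unit.
rewrite (gauss_equation oO (CF 3) CV FF VV VFo VF metricE gu Ox).
set T := tangent_mx F x; set D := dN_mx Nrad (rho *: f x).
have TN : T *m (normal_mx V x)^T = rho *: (T *m D *m T^T).
  rewrite (normal_mxE Ox) linearZ /= -scalemxAr; congr (_ *: _).
  by rewrite -[RHS](plaque_shape_symmetric Ox) !trmx_mul trmxK mulmxA.
have [_ PDPD t1 t2 _] := leaf_traces (Ck_Nrad 2) Nrad_unit Nrad_orth (fun x a => @Nrad_radial x a)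
  (Of Ox) (plaque_gram_unit Ox) (plaque_normal_orth Ox) (plaque_position_orth Ox).
rewrite (metric_mx Ox) -/T TN -!scalemxAr -!scalemxAl !linearZ /=.
rewrite shape_trace shape_trace2 -/T -/D in t1 t2 PDPD *.
rewrite PDPD t1 t2 /nsigma2 (nf1 Ox) /sigma2.
have fin (k q s t : R) : k + (q * s) ^+ 2 + q *: (q *: - t) = k + 2 * (q ^+ 2 * (2^-1 * (s * s - t))).
  by rewrite /GRing.scale /=; field.
exact: fin.
Qed.
End Plaque.

(** The rows of J are the coordinate vectors of the plaque through x / |x|.  The plaque lies in one
    leaf, along which the scalar curvature, hence [nsigma2], is constant and positive. *)
Lemma leaf_frame x : Om x -> exists J : 'M[R]_(n, n.+2),
  [/\ [/\ J *m J^T \in unitmx, J *m (normal_row Nrad x)^T = 0 & J *m x^T = 0],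
      (J *m dN_mx Nrad x *m J^T)^T = J *m dN_mx Nrad x *m J^T,
      forall i, \sum_b J i b * pderiv b (nsigma2 Nrad) x = 0
    & 0 < nsigma2 Nrad x].
Proof.
move=> Ox; have [c [x0 [y [Ac cz E]]]] := chart_at (ray_sphere Ox).
pose rho := Num.sqrt (normsq x).
have rho0 : 0 < rho by rewrite sqrtr_gt0.
have xE : rho *: plaque_map c y x0 = x.
  by rewrite E /ray scalerA mulfV ?scale1r// gt_eqF.
exists (tangent_mx (fun a w => plaque_map c y w 0 a) x0).
have Lleaf : is_leaf S A [set q | same_leaf A (plaque_map c y x0) q].
  by exists (plaque_map c y x0) => //; rewrite E; exact: ray_sphere.
have [r r1 scal] := leaf_scal Lleaf.
have n2R : 2 <= n%:R :> R by rewrite ler_nat.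
have sf_const w : slice_dom y w ->
    nsigma2 Nrad (rho *: plaque_map c y w) = 2^-1 * (n%:R * (n%:R - 1) * (r - 1)).
  move=> cw; have := plaque_scalar_curvature Ac rho0 cw.
  rewrite (scal c w y Ac cw); last first.
    by apply: same_leaf_plaque; exists c, x0, w, y.
  by move=> H; lra.
split.
- split.
  + exact: (plaque_gram_unit Ac cz).
  + by have := plaque_normal_orth Ac rho0 cz; rewrite xE.
  + by have := plaque_position_orth rho Ac cz; rewrite xE.
- by have := plaque_shape_symmetric Ac rho0 cz; rewrite /= xE.
- move=> i; apply: (mulfI (lt0r_neq0 rho0)); rewrite mulr0.
  have Csf' := C1_nsigma2 (Ck_Nrad 2).
  have := pderiv_along_plaque Ac rho0 i cz Csf'; rewrite xE => H.
  transitivity (pderiv i (fun w => nsigma2 Nrad (rho *: plaque_map c y w)) x0).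
    by rewrite H; congr (_ * _); apply: eq_bigr => b _; rewrite mxE.
  by rewrite (eq_pderiv i (@open_slice_dom R n y) cz sf_const) pderiv_cst.
- rewrite -xE (sf_const _ cz) pmulr_rgt0 ?invr_gt0// !mulr_gt0//; lra.
Qed.

(** The gradient is orthogonal to the leaf and, by homogeneity, to x. *)
Lemma grad_nsigma2_normal x : Om x -> exists lam, forall a, pderiv a (nsigma2 Nrad) x = lam * Nrad a x.
Proof.
move=> Ox; have [J [[Ju JN Jx] _ Jg _]] := leaf_frame Ox.
pose v : 'rV[R]_n.+2 := \row_b pderiv b (nsigma2 Nrad) x.
have Jv : J *m v^T = 0.
  apply/matrixP => i j; rewrite [LHS]mxE [RHS]mxE -[RHS](Jg i).
  by apply: eq_bigr => b _; rewrite !mxE.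
have xv : x *m v^T = 0.
  apply/matrixP => i j; rewrite [LHS]mxE [RHS]mxE.
  rewrite -[RHS](radial_nsigma2 (Ck_Nrad 2) (fun x a => @Nrad_radial x a) Ox).
  by apply: eq_bigr => b _; rewrite !mxE !ord1.
have := leaf_projection Nrad_unit Nrad_orth Ox Ju JN Jx.
move=> /(congr1 (fun B => B *m v^T)); rewrite -mulmxA Jv mulmx0 !mulmxBl mul1mx -scalemxAl.
rewrite -!mulmxA xv mulmx0 scaler0 subr0 => /esym/subr0_eq vE.
exists ((normal_row Nrad x *m v^T) 0 0) => a.
have := congr1 (fun B : 'cV[R]_n.+2 => B a 0) vE.
by rewrite !mxE big_ord1 !mxE mulrC.
Qed.

End Foliated.

(** * Cutoff and conclusion *)

Section Cutoff.
Context {R : realType}.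

(** The square of the positive part: a function of class C^1 that vanishes for t <= 0. *)
Definition bump (t : R) : R := 2^-1 * (t * (t + `|t|)).

Lemma bump_ge0 t : 0 <= bump t.
Proof.
rewrite /bump; have [t0|t0] := leP 0 t.
  by rewrite !mulr_ge0 ?addr_ge0 ?invr_ge0.
by rewrite ltr0_norm// subrr !mulr0.
Qed.

Lemma bump_gt0 t : 0 < t -> 0 < bump t.
Proof. by move=> t0; rewrite /bump !mulr_gt0 ?invr_gt0// addr_gt0// normr_gt0 gt_eqF. Qed.

Lemma bump_eq0 t : t <= 0 -> bump t = 0.
Proof. by move=> t0; rewrite /bump ler0_norm// subrr !mulr0. Qed.

Lemma continuous_bump_derivative : continuous (fun t : R => t + `|t|).
Proof. by move=> t; apply: continuousD; [exact: cvg_id|exact: norm_continuous]. Qed.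

Lemma is_derive_bump (t : R) : is_derive t 1 bump (t + `|t|).
Proof.
have [t0|t0|->] := ltgtP t 0.
- rewrite (ltr0_norm t0) subrr.
  have E : \near t, (fun=> 0) t = bump t.
    by near=> s; rewrite bump_eq0//; apply/ltW; near: s; exact: lt_nbhsl.
  exact: near_eq_is_derive E (is_derive_cst _ _ _).
- rewrite (gtr0_norm t0).
  have E : \near t, t * t = bump t.
    near=> s; have s0 : 0 < s by near: s; exact: lt_nbhsr.
    by rewrite /bump gtr0_norm//; field.
  apply: near_eq_is_derive E _.
  by apply: is_derive_eq; rewrite /GRing.scale /= mulr1.
- rewrite normr0 addr0.
  have L : (fun h : R => h^-1 *: ((bump \o shift 0) (h *: (1:R)) - bump 0)) @ 0^' --> (0 : R).
    have cc : {for (0 : R), continuous (fun h : R => 2^-1 * (h + `|h|))}.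
      have c1 : {for (0 : R), continuous (fun _ : R => 2^-1 : R)} by exact: cst_continuous.
      have c2 : {for (0 : R), continuous (fun t : R => t + `|t|)} by exact: continuous_bump_derivative.
      exact: continuousM c1 c2.
    have c0 : (fun h : R => 2^-1 * (h + `|h|)) @ 0^' --> (0 : R).
      apply: cvg_within_filter; move: cc.
      by rewrite /prop_for /continuous_at normr0 addr0 mulr0.
    apply: cvg_trans c0; apply: near_eq_cvg; near=> h.
    have h0 : h != 0 by near: h; exact: nbhs_dnbhs_neq.
    rewrite /= addr0 [bump 0]bump_eq0// subr0 [h *: 1]mulr1 /bump /GRing.scale /=.
    by field.
  by split; [exact: cvgP L|exact: cvg_lim L].
Unshelve. all: by end_near. Qed.

End Cutoff.

Section SignField.
Context {R : realType} {m : nat} (O : set 'rV[R]_m) (g : 'rV[R]_m -> R).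
Hypothesis oO : open O.
Hypothesis Cg : Ck 0 O g.
Hypothesis g0 : forall x, O x -> g x != 0.

Lemma sign_locally_constant x : O x -> exists U, [/\ open U, U x, U `<=` O
  & forall y, U y -> Num.sg (g y) = Num.sg (g x)].
Proof.
move=> Ox; have cg y : O y -> {for y, continuous g} by exact: (Ck_continuous Cg).
have [g_neg|g_pos|E] := ltgtP (g x) 0.
- exists (O `&` g @^-1` [set t | t < 0]); split => //.
  + exact: (open_preimage oO (@open_lt R 0) cg).
  + by move=> y [_ /= gy]; rewrite !ltr0_sg.
- exists (O `&` g @^-1` [set t | 0 < t]); split => //.
  + exact: (open_preimage oO (@open_gt R 0) cg).
  + by move=> y [_ /= gy]; rewrite !gtr0_sg.
- by have := g0 Ox; rewrite E eqxx.
Qed.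

Lemma Ck_sign k : Ck k O (fun x => Num.sg (g x)).
Proof.
apply: Ck_local => x Ox; have [U [oU accN_position _ Us]] := sign_locally_constant Ox.
by exists U => //; apply: Ck_ext (Ck_cst k U (Num.sg (g x))) => // y Uy; rewrite Us.
Qed.

Lemma pderiv_sign i x : O x -> pderiv i (fun x => Num.sg (g x)) x = 0.
Proof.
move=> Ox; have [U [oU accN_position _ Us]] := sign_locally_constant Ox.
by rewrite (eq_pderiv i oU accN_position Us) pderiv_cst.
Qed.

End SignField.

Theorem theorem2 (R : realType) (n : nat) (n_ge2 : (2 <= n)%N) :
  ~ exists A : set (chart R n n.+2),
      [/\ foliation (unit_sphere R n.+1) A,
          transversely_orientable (unit_sphere R n.+1) A
        & forall L : set 'rV[R]_n.+2, is_leaf (unit_sphere R n.+1) A L ->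
            complete_leaf A L /\
            exists2 r : R, 1 < r & leaf_scalar_curvature A L r].
Proof.
case=> A [fol [N [sN N1 Ntan Northo]] leaves].
have scal L : is_leaf (unit_sphere R n.+1) A L -> exists2 r : R, 1 < r & leaf_scalar_curvature A L r.
  by move=> /leaves[].
pose Om := [set x : 'rV[R]_n.+2 | 0 < normsq x].
have oOm : open Om := @open_punctured R n.+2.
pose s1 := divN (Nrad N); pose Z := wfield (Nrad N).
have CN a : Ck 2 Om (Nrad N a) by exact: Ck_Nrad.
have NN x : Om x -> \sum_a Nrad N a x * Nrad N a x = 1 by exact: Nrad_unit.
have Nx x : Om x -> \sum_a Nrad N a x * x 0 a = 0 by exact: (Nrad_orth fol Ntan).
have xD x a : Om x -> \sum_b x 0 b * pderiv b (Nrad N a) x = 0 by exact: Nrad_radial.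
pose E x := 2 * trN3 (Nrad N) x - 2 * s1 x * trN2 (Nrad N) x - (2 * n.+2%:R - 7) * s1 x * (normsq x)^-1.
have sign x : Om x -> s1 x != 0 /\ 0 < Num.sg (- s1 x) * E x.
  move=> Ox; have [J [[Ju JN Jx] Js _ sf0]] := leaf_frame n_ge2 fol sN N1 Ntan Northo scal Ox.
  exact: (divergence_sign CN NN Nx xD Ox Ju JN Jx Js sf0 n_ge2).
have divZ x : Om x -> \sum_a pderiv a (Z a) x = expR (2 * nsigma2 (Nrad N) x) * E x.
  move=> Ox; have [lam grad] := grad_nsigma2_normal n_ge2 fol sN N1 Ntan Northo scal Ox.
  exact: (div_wfield CN NN Nx xD Ox grad).
have Ns0 x : Om x -> - s1 x != 0 by move=> Ox; rewrite oppr_eq0; exact: (sign x Ox).1.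
have CNs : Ck 1 Om (fun x => - s1 x) := CkN oOm (C1_divN CN).
pose sg x := Num.sg (- s1 x).
have Csg : Ck 1 Om sg := Ck_sign oOm (Ck_pred CNs) Ns0 1.
(* positive exactly for 1 < |x|^2 < 4 *)
pose w (x : 'rV[R]_n.+2) := (normsq x - 1) * (4 - normsq x).
have Cq k O : open O -> Ck k O (@normsq R n.+2) by exact: Ck_normsq.
have Cw : Ck 1 Om w.
  apply: (CkM oOm); apply: (CkB oOm); first [exact: Cq | exact: Ck_cst].
have Cchi : Ck 1 Om (fun x => bump (w x)).
  exact: (C1_comp_scalar oOm (@is_derive_bump R) (@continuous_bump_derivative R) Cw).
pose c x := bump (w x) * sg x.
have Cc : Ck 1 Om c := CkM oOm Cchi Csg.
pose W a x := c x * Z a x.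
have CW a : Ck 1 Om (W a) := CkM oOm Cc (C1_wfield CN a).
have w_out x : normsq x <= 1 \/ 4 <= normsq x -> forall a, W a x = 0.
  move=> qx a; rewrite /W /c bump_eq0 ?mul0r// /w.
  by case: qx => qx; [rewrite mulr_le0_ge0|rewrite mulr_ge0_le0]; lra.
pose B := [set x : 'rV[R]_n.+2 | normsq x < 1].
have oB : open B.
  have cq (x : 'rV[R]_n.+2) : setT x -> {for x, continuous (@normsq R n.+2)}.
    exact: (Ck_continuous (Cq 0 setT openT)).
  by have := open_preimage openT (@open_lt R 1) cq; rewrite setTI.
have W_B x a : B x -> W a x = 0 by move=> Bx; apply: w_out; left; exact: ltW.
have CW_all a : Ck 1 setT (W a).
  apply: Ck_local => x _; have [qx|qx] := ltP (normsq x) 1.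
    exists B; first exact: qx.
    by apply: Ck_ext (Ck_cst 1 B 0) => // y By; rewrite W_B.
  by exists Om; [exact: lt_le_trans ltr01 qx|exact: CW].
have divW x : Om x -> \sum_a pderiv a (W a) x = bump (w x) * expR (2 * nsigma2 (Nrad N) x) * (sg x * E x).
  move=> Ox.
  have C1 : Ck 1 Om (fun y => normsq y - 1) := CkB oOm (Cq 1 Om oOm) (Ck_cst 1 Om 1).
  have C2 : Ck 1 Om (fun y => 4 - normsq y) := CkB oOm (Ck_cst 1 Om 4) (Cq 1 Om oOm).
  have dw a : pderiv a w x = x 0 a * (10 - 4 * normsq x).
    rewrite (pderiv_mul a Ox C1 C2) (pderiv_sub a Ox (Cq 1 Om oOm) (Ck_cst 1 Om 1)).
    rewrite (pderiv_sub a Ox (Ck_cst 1 Om 4) (Cq 1 Om oOm)) !pderiv_cst pderiv_normsq.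
    by move: (x 0 a) (normsq x) => u q; ring.
  have dc a : pderiv a c x = sg x * (w x + `|w x|) * (10 - 4 * normsq x) * x 0 a.
    rewrite (pderiv_mul a Ox Cchi Csg) (pderiv_sign oOm (Ck_pred CNs) Ns0 a Ox) mulr0 addr0.
    have [_ E1] := chain_rule_scalar oOm a Cw Ox (is_derive_bump (w x)).
    rewrite [pderiv a _ x]E1 dw.
    by move: (sg x) (w x + `|w x|) (10 - 4 * normsq x) (x 0 a) => p q r t; ring.
  have dW a : pderiv a (W a) x = sg x * (w x + `|w x|) * (10 - 4 * normsq x) * (Z a x * x 0 a)
      + c x * pderiv a (Z a) x.
    by rewrite (pderiv_mul a Ox Cc (C1_wfield CN a)) dc; congr (_ + _); rewrite [RHS]mulrA [LHS]mulrAC.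
  (* the derivative of the cutoff is radial, and the field is orthogonal to x *)
  rewrite (eq_bigr _ (fun a _ => dW a)) big_split /= -!mulr_sumr (wfield_orth_position CN NN Nx Ox).
  rewrite mulr0 add0r divZ// /c.
  by move: (bump _) (sg x) (expR _) (E x) => p q r t; ring.
have divW0 x : 0 <= \sum_a pderiv a (W a) x.
  have [qx|qx] := ltP (normsq x) 1.
    rewrite big1// => a _.
    by rewrite (eq_pderiv a oB qx (fun y By => W_B y a By)) pderiv_cst.
  have Ox : Om x by rewrite /Om /=; lra.
  rewrite divW//; apply: mulr_ge0; last exact: ltW (sign x Ox).2.
  by rewrite mulr_ge0 ?bump_ge0 ?expR_ge0.
(* a centre inside the shell; a coordinate at distance 4 from its own is at least 5/2 in size *)
pose x0 : 'rV[R]_n.+2 := (3 / 2) *: delta_mx 0 0.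
have qx0 : normsq x0 = 9 / 4.
  rewrite normsqZ /normsq (bigD1 0)//= big1 => [|a a0].
    by rewrite !mxE eqxx /=; field.
  by rewrite mxE (negPf a0) andbF mul0r.
have L0 : (0 : R) < 4 by [].
have far i (x : 'rV[R]_n.+2) : `|x 0 i - x0 0 i| = 4 -> W i x = 0.
  move=> xi; apply: w_out; right.
  have x0i : `|x0 0 i| <= 3 / 2.
    by rewrite !mxE /= normrM; case: (i == 0); rewrite ?normr1 ?normr0 ?mulr1 ?mulr0 ?ger0_norm//; lra.
  have xi2 : 5 / 2 <= `|x 0 i|.
    have : `|x 0 i - x0 0 i| <= `|x 0 i| + `|x0 0 i| by exact: ler_normB.
    by rewrite xi; lra.
  apply: (@le_trans _ _ (x 0 i * x 0 i)).
    rewrite -expr2 -real_normK ?num_real//; apply: (@le_trans _ _ ((5 / 2) ^+ 2)); first lra.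
    by rewrite ler_pXn2r ?nnegrE//; lra.
  rewrite /normsq (bigD1 i)//= lerDl sumr_ge0// => a _.
  by rewrite -expr2 sqr_ge0.
have := compact_support_divergence L0 (fun i x => @Ck_derivable _ _ _ _ _ _ i (CW_all i) I)
  (fun i x => Ck_continuous (Ck_pderiv i (CW_all i)) I) far divW0.
have Ox0 : Om x0 by rewrite /Om /= qx0; lra.
rewrite (divW x0 Ox0) => /eqP; apply/negP; rewrite gt_eqF//.
apply: mulr_gt0; last exact: (sign x0 Ox0).2.
apply: mulr_gt0; last exact: expR_gt0.
by apply: bump_gt0; rewrite /w qx0; lra.
Qed.
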